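(* Let $q>0$, and let $\mathcal{T}$ be the family of (edge sets of) spanning trees of the complete graph $K_n$. Equip the edges of $K_n$ with i.i.d. weights $X_e$, each distributed as $U^{1/q}$ where $U\sim U(0,1)$, and let $M(\mathcal{T})=\min_{T\in\mathcal{T}}\sum_{e\in T}X_e$. Then there exists a constant $c_q$ such that, with $L:=c_q n^{1-1/q}$, \[ \frac{|M(\mathcal{T})-L|}{L}=O_{\mathbb{P}}\!\left(n^{-\frac{q}{2(q+1)}}\right)=o_{\mathbb{P}}(1)\quad\text{as } n\to\infty. \]
   Context: For sequences of random variables $X_n,Y_n$: $X_n=o_{\mathbb{P}}(Y_n)$ means $X_n/Y_n\to 0$ in probability; $X_n=O_{\mathbb{P}}(Y_n)$ means that for every $\varepsilon>0$ there is a constant $C>0$ such that $X_n\le CY_n$ with probability at least $1-\varepsilon$ for all sufficiently large $n$. *)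

(* Defs.v *)
From HB Require Import structures.
From mathcomp Require Import all_boot all_order all_algebra.
From mathcomp Require Import all_classical all_reals all_analysis.

Set Implicit Arguments.
Unset Strict Implicit.
Unset Printing Implicit Defensive.

Import Order.TTheory GRing.Theory Num.Theory.
Import numFieldNormedType.Exports.

Local Open Scope classical_set_scope.
Local Open Scope ring_scope.

(* The edges of the complete graph on the vertex set 'I_n. *)
Definition edge (n : nat) := {e : {set 'I_n} | (#|e| == 2)%N}.

Definition adj (n : nat) (T : {set edge n}) : rel 'I_n :=
  fun u v => [exists e in T, val e == [set u; v]%SET].

Definition connected_graph (n : nat) (T : {set edge n}) : Prop :=
  forall u v : 'I_n, connect (adj T) u v.

(* [size c >= 3] rules out [:: u; v] with u and v adjacent, which [ucycle]
   accepts although it goes back and forth along a single edge. *)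
Definition acyclic (n : nat) (T : {set edge n}) : Prop :=
  forall c : seq 'I_n, (3 <= size c)%N -> ~ ucycle (adj T) c.

Definition spanning_tree (n : nat) (T : {set edge n}) : Prop :=
  [/\ (0 < n)%N, connected_graph T & acyclic T].

(* The infimum is over a finite set, nonempty when n > 0, hence a minimum:
   see [mst_weight_min]. *)
Definition mst_weight (R : realType) (n : nat) (x : edge n -> R) : R :=
  inf [set \sum_(e in T) x e | T in @spanning_tree n].

Section star.
Variable n : nat.

Let star : {set edge n.+1} := [set e : edge n.+1 | ord0 \in (val e : {set 'I_n.+1})]%SET.

Let adj_star u v : adj star u v = (u != v) && ((u == ord0) || (v == ord0)).
Proof.
apply/existsP/andP => [[e /andP[]]|[uv u0]].
  rewrite inE => e0 /eqP eE; move: e0 (valP e); rewrite eE !inE cards2.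
  rewrite (eq_sym ord0 u) (eq_sym ord0 v) => u0 uv2; split=> //.
  by case: (u =P v) uv2.
have uv2 : (#|[set u; v]%SET| == 2)%N by rewrite cards2 uv.
exists (exist _ [set u; v]%SET uv2).
by rewrite !inE /= (eq_sym ord0 u) (eq_sym ord0 v) u0 /=.
Qed.

Lemma spanning_tree_exists : exists T : {set edge n.+1}, spanning_tree T.
Proof.
exists star; split => //.
  have c0 u : connect (adj star) ord0 u && connect (adj star) u ord0.
    have [->|u0] := eqVneq u ord0; first by rewrite connect0.
    by rewrite !connect1 // adj_star eqxx ?orbT andbT // eq_sym.
  move=> u v; have /andP[_ h1] := c0 u; have /andP[h2 _] := c0 v.
  exact: connect_trans h1 h2.
move=> [|a [|b [|c s]]] //= _ /andP[].
rewrite /= rcons_path /= !adj_star !inE !negb_or.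
move=> /and4P[/andP[_ ab0] /andP[_ bc0] _ /andP[_ la0]].
move=> /and4P[/and3P[ab ac as_] /andP[bc bs] cs us].
have [b0|b0] := eqVneq b ord0; last first.
  move: ab0 bc0; rewrite (negbTE b0) orbF /= => /eqP a0 /eqP c0.
  by rewrite a0 c0 eqxx in ac.
have a0 : a != ord0 by rewrite -b0.
move: la0; rewrite (negbTE a0) orbF -b0 => /eqP lb.
have := mem_last c s; rewrite lb inE (negbTE bs) orbF.
by rewrite (negbTE bc).
Qed.

End star.

Lemma mst_weight_min (R : realType) (n : nat) (x : edge n -> R) : (0 < n)%N ->
  (exists2 T, spanning_tree T & mst_weight x = \sum_(e in T) x e) /\
  (forall T, spanning_tree T -> mst_weight x <= \sum_(e in T) x e).
Proof.
case: n x => // n x _.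
have [T0 hT0] := spanning_tree_exists n.
have hT0b : `[< spanning_tree T0 >] by apply/asboolP.
case: (@arg_minP _ _ _ T0 (fun T => `[< spanning_tree T >])
  (fun T => \sum_(e in T) x e) hT0b) => T /asboolP hT Tmin.
have lbT T' : spanning_tree T' -> \sum_(e in T) x e <= \sum_(e in T') x e.
  by move=> hT'; apply: Tmin; apply/asboolP.
suff -> : mst_weight x = \sum_(e in T) x e by split; [exists T|].
apply/eqP; rewrite eq_le; apply/andP; split.
  apply: ge_inf; last by exists T.
  by exists (\sum_(e in T) x e) => _ [T' hT' <-]; exact: lbT.
apply: lb_le_inf; first by exists (\sum_(e in T) x e), T.
by move=> _ [T' hT' <-]; exact: lbT.
Qed.

Definition independent_RVs (R : realType) (d : measure_display)
    (Omega : measurableType d) (P : probability Omega R) (I : finType)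
    (X : I -> {RV P >-> R}) : Prop :=
  forall (J : {set I}) (B : I -> set R), (forall i, measurable (B i)) ->
    P (\bigcap_(i in [set` J]) (X i @^-1` B i)) =
    (\prod_(i in J) P (X i @^-1` B i))%E.

(* X has the law of U^{1/q} with U uniform on (0, 1). *)
Definition uniform_root_law (R : realType) (q : R) (d : measure_display)
    (Omega : measurableType d) (P : probability Omega R)
    (X : {RV P >-> R}) : Prop :=
  forall A : set R, measurable A ->
    distribution P X A =
    pushforward (uniform_prob (@ltr01 R)) (fun u : R => u `^ q^-1) A.

Section stochastic_landau.
Variables (R : realType) (d : nat -> measure_display).
Variables (Omega : forall n, measurableType (d n)).
Variable P : forall n, probability (Omega n) R.

Definition bigO_prob (X Y : forall n, Omega n -> R) : Prop :=
  forall eps : R, 0 < eps -> exists2 C : R, 0 < C &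
    \forall n \near \oo,
      ((1 - eps)%:E <= P n [set w | (X n w <= C * Y n w)%R])%E.

Definition littleo_prob (X Y : forall n, Omega n -> R) : Prop :=
  forall eps : R, 0 < eps ->
    P n [set w | eps < `|X n w / Y n w|] @[n --> \oo] --> 0%E.

End stochastic_landau.

(* Main.v *)
(** Kruskal's algorithm gives [M = \int_0^1 (kappa(G_t) - 1) dt], where [G_t] is the
    graph of the edges of weight at most [t] and [kappa] counts its components; [G_t]
    is an Erdos-Renyi graph with edge probability [t^q].  Rescaling [t = n^(-1/q) s], the
    limit is [c_q = \int_0^oo f(s^q) ds], where [f(c)] is the limit of
    [E kappa(G(n, c/n)) / n], namely [f(c) = \sum_k T_k c^(k-1) e^(-kc) / k!] with [T_k]
    the number of trees on [k] labelled vertices.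

    Three estimates give the rate.  Truncating at components of size [sqrt n / (1 + c)]
    and comparing term by term, using only [\sum_k k f_k <= 1] (the sizes of the
    components add up to [n]), the bias of [kappa / n] is [O((1 + c) / sqrt n)].  The
    Efron-Stein inequality bounds the variance of [kappa] by the expected number of edges.
    Finally [G_t] is connected with high probability once [s >= J = n^eta] for any fixed
    [eta > 0], so only [s <= J] matters and the total relative error is
    [O(J^(1+q) / sqrt n)], which is [n^(-q/(2(q+1)))] for [eta = 1/(2(q+1)^2)].

    The integral over [s] is replaced by dyadic Riemann sums, which is harmless because
    [kappa] and [f] are monotone. *)

Require Import Defs.
From HB Require Import structures.
From mathcomp Require Import all_boot zify.

Set Implicit Arguments.
Unset Strict Implicit.
Unset Printing Implicit Defensive.

(** * Components and spanning forests *)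

(** What is known of [f] is inherited from the finite graphs. Letting [n] grow for a fixed number of
    terms turns the identity for component sizes into [\sum_k k f_k <= 1]. This bounds the tail of
    the series by [1 / K]; at [c = 1] it also bounds [T_k / k!] by [e^k], whence the exponential
    decay of [f]. Likewise [f] is antitone because the mean of [kappa] is.

    The graphs [G_t] at different [t] are strongly dependent. The errors at all thresholds are
    therefore added first and Markov's inequality is applied once to the sum, so that only the law
    of each single [G_t] matters and the grid can be arbitrarily fine.

    The exponent [eta] solves [eta (1 + q) - 1/2 = - q / (2 (q + 1))]. The tail beyond [J] must then
    be of order [J^(- q (q + 1))], which the exponential decay of [f] supplies for every [q]. *)

Section graph.
Variable n : nat.
Implicit Types (E F G T : {set edge n}) (e : edge n) (u v w a b : 'I_n).
Implicit Types (S : {set 'I_n}).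

Lemma edgeP e : exists a b, a != b /\ val e = [set a; b].
Proof.
have /eqP/esym/eqP := valP e; rewrite eq_sym => /cards2P[a [b [ab eE]]].
by exists a, b.
Qed.

Lemma adjP E u v :
  reflect (exists2 e, e \in E & val e = [set u; v]) (adj E u v).
Proof.
apply: (iffP existsP) => [[e /andP[eE /eqP ve]]|[e eE ve]]; exists e => //.
by rewrite eE ve eqxx.
Qed.

Lemma adj_sym E u v : adj E u v = adj E v u.
Proof. by rewrite /adj setUC. Qed.

Lemma adj_neq E u v : adj E u v -> u != v.
Proof.
by case/adjP => e _ ve; have := valP e; rewrite ve cards2; case: (u != v).
Qed.

Lemma connectC E u v : connect (adj E) u v = connect (adj E) v u.
Proof. by apply: sym_connect_sym => a b; rewrite adj_sym. Qed.

Lemma adj_sub E F u v : E \subset F -> adj E u v -> adj F u v.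
Proof. by move=> sEF /adjP[e eE ve]; apply/adjP; exists e => //; apply: (subsetP sEF). Qed.

Lemma connect_subset E F u v : E \subset F ->
  connect (adj E) u v -> connect (adj F) u v.
Proof.
move=> sEF; apply: connect_sub => {u v} u v uv.
by apply: connect1; apply: adj_sub uv.
Qed.

Definition component E v : {set 'I_n} := [set u | connect (adj E) v u].
Definition comps E : {set {set 'I_n}} := (component E @: [set: 'I_n]).
Definition kappa E : nat := #|comps E|.

Lemma mem_component E u v : (u \in component E v) = connect (adj E) v u.
Proof. by rewrite inE. Qed.

Lemma component_refl E v : v \in component E v.
Proof. by rewrite inE. Qed.

Lemma eq_componentE E u v : (component E u == component E v) = connect (adj E) u v.
Proof.
apply/eqP/idP => [Euv|uv]; first by rewrite -mem_component Euv component_refl.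
apply/setP => w; rewrite !inE; apply/idP/idP; apply: connect_trans => //.
by rewrite connectC.
Qed.

Lemma component_in E v : component E v \in comps E.
Proof. exact: imset_f. Qed.

Lemma compsP E S : reflect (exists v, S = component E v) (S \in comps E).
Proof. by apply: (iffP imsetP) => [[v _ ->]|[v ->]]; exists v. Qed.

Lemma kappa0 : kappa set0 = n.
Proof.
rewrite /kappa /comps card_imset ?cardsT ?card_ord // => u v Euv.
have : connect (adj (set0 : {set edge n})) u v by rewrite -eq_componentE Euv.
case/connectP => -[_ -> //|w p /= /andP[/adjP[e]]].
by rewrite inE.
Qed.

Lemma kappa_gt0 E : (0 < n)%N -> (0 < kappa E)%N.
Proof.
by move=> n0; apply/card_gt0P; exists (component E (Ordinal n0)); apply: component_in.
Qed.

Lemma connect_ind_l E u (Q : 'I_n -> Prop) : Q u ->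
  (forall v w, Q v -> adj E v w -> Q w) -> forall v, connect (adj E) u v -> Q v.
Proof.
move=> Qu Qstep v /connectP[p]; elim: p u Qu => [|w p IH] u Qu /=; first by move=> _ ->.
by move=> /andP[uw wp] vE; apply: IH wp vE; apply: Qstep uw.
Qed.

Lemma adj_add E e a b u v : val e = [set a; b] ->
  adj (e |: E) u v ->
  [\/ adj E u v, u = a /\ v = b | u = b /\ v = a].
Proof.
move=> ve /adjP[e']; rewrite !inE => /orP[/eqP->|e'E] ve'; last first.
  by constructor 1; apply/adjP; exists e'.
have ab : a != b by have := valP e; rewrite ve cards2; case: (a != b).
have : u \in [set a; b] by rewrite -ve ve' !inE eqxx.
have : v \in [set a; b] by rewrite -ve ve' !inE eqxx orbT.
have uv : u != v.
  by apply: (@adj_neq (e |: E)); apply/adjP; exists e => //; rewrite !inE eqxx.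
rewrite !inE => /orP[]/eqP Hv /orP[]/eqP Hu; subst u v.
- by rewrite eqxx in uv.
- by constructor 3.
- by constructor 2.
- by rewrite eqxx in uv.
Qed.

Lemma adj_new E e a b : val e = [set a; b] -> adj (e |: E) a b.
Proof. by move=> ve; apply/adjP; exists e => //; rewrite !inE eqxx. Qed.

(** Induction along the path: crossing the new edge a second time leads back to the old component
    left at the first crossing. *)
Lemma connect_add E e a b u v : val e = [set a; b] ->
  connect (adj (e |: E)) u v ->
  [\/ connect (adj E) u v,
      connect (adj E) u a /\ connect (adj E) b v |
      connect (adj E) u b /\ connect (adj E) a v].
Proof.
move=> ve; move: v; apply: connect_ind_l; first by constructor 1; exact: connect0.
move=> v w H /(adj_add ve) [vw|[va wb]|[vb wa]].
- have vw1 := connect1 vw.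
  case: H => [H|[H1 H2]|[H1 H2]].
  + by constructor 1; exact: connect_trans vw1.
  + by constructor 2; split=> //; exact: connect_trans vw1.
  + by constructor 3; split=> //; exact: connect_trans vw1.
- subst v w; case: H => [H|[H1 H2]|[H1 H2]].
  + by constructor 2; split=> //; exact: connect0.
  + by constructor 2; split=> //; exact: connect0.
  + by constructor 1.
- subst v w; case: H => [H|[H1 H2]|[H1 H2]].
  + by constructor 3; split=> //; exact: connect0.
  + by constructor 1.
  + by constructor 3; split=> //; exact: connect0.
Qed.

(** The map [h] sends a component of [E] to the component of [F] around it, written as a union
    because a component carries no chosen vertex. The hypothesis says that [D] already reaches every
    component of [F]. *)
Lemma comps_surj E F (D : {set {set 'I_n}}) : E \subset F ->
  (forall v, exists2 w, connect (adj F) v w & component E w \in D) ->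
  (kappa F <= #|D|)%N.
Proof.
move=> sEF H.
pose h (S : {set 'I_n}) : {set 'I_n} := (\bigcup_(v in S) component F v).
have hE w : h (component E w) = component F w.
  apply/setP => z; apply/bigcupP/idP => [[v]|wz].
    rewrite mem_component => wv; rewrite !mem_component; apply: connect_trans.
    exact: connect_subset wv.
  by exists w => //; exact: component_refl.
apply: leq_trans (leq_imset_card h D); apply: subset_leq_card.
apply/subsetP => S /compsP[v ->]; have [w vw wD] := H v.
apply/imsetP; exists (component E w) => //; rewrite hE.
by apply/eqP; rewrite eq_componentE.
Qed.

Lemma kappa_sub E F : E \subset F -> (kappa F <= kappa E)%N.
Proof.
by move=> sEF; apply: comps_surj sEF _ => v; exists v => //; exact: component_in.
Qed.

Lemma subset_add E e : E \subset (e |: E).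
Proof. exact: subsetUr. Qed.

(** Only the components of the two ends of [e] can merge, so the merging map is injective once the
    component of [b] is set aside. *)
Lemma kappa_add E e : (kappa E <= (kappa (e |: E)).+1)%N.
Proof.
have [a [b [ab ve]]] := edgeP e.
rewrite /kappa (cardsD1 (component E b)) component_in add1n ltnS.
pose h (S : {set 'I_n}) : {set 'I_n} := (\bigcup_(v in S) component (e |: E) v).
have hE w : h (component E w) = component (e |: E) w.
  apply/setP => z; apply/bigcupP/idP => [[v]|wz].
    rewrite mem_component => wv; rewrite !mem_component; apply: connect_trans.
    exact: connect_subset (subset_add _ _) wv.
  by exists w => //; exact: component_refl.
rewrite -(@card_in_imset _ _ h (comps E :\ component E b)).
  apply: subset_leq_card; apply/subsetP => S /imsetP[S']; rewrite !inE.
  by move=> /andP[_ /compsP[v ->]] ->; rewrite hE component_in.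
move=> S1 S2; rewrite !inE => /andP[nb1 /compsP[u uE]] /andP[nb2 /compsP[v vE]].
rewrite uE vE !hE => /eqP; rewrite eq_componentE => /(connect_add ve) uv.
apply/eqP; rewrite eq_componentE.
move: nb1 nb2; rewrite uE vE !eq_componentE => nu nv.
case: uv => // [[_ bv]|[ub _]]; last by rewrite ub in nu.
by rewrite connectC bv in nv.
Qed.

Lemma kappa_add_lt E e a b : val e = [set a; b] -> ~~ connect (adj E) a b ->
  (kappa (e |: E) < kappa E)%N.
Proof.
move=> ve nab; rewrite /kappa (cardsD1 (component E b) (comps E)) component_in add1n ltnS.
apply: comps_surj (subset_add _ _) _ => v.
have [vb|vb] := boolP (connect (adj E) v b).
  exists a.
    apply: (@connect_trans _ _ b); first exact: connect_subset (subset_add _ _) vb.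
    by rewrite connectC; apply: connect1; exact: adj_new.
  by rewrite !inE component_in andbT eq_componentE.
by exists v; rewrite ?connect0 // !inE component_in andbT eq_componentE.
Qed.

Lemma kappa_addU E F : (kappa E <= kappa (F :|: E) + #|F|)%N.
Proof.
have [m] := ubnP #|F|; elim: m F => // m IH F.
have [->|[e eF]] := set_0Vmem F; first by rewrite set0U cards0 addn0.
rewrite (cardsD1 e) eF add1n ltnS => Fm.
apply: leq_trans (IH _ Fm) _; rewrite addnS -addSn leq_add2r.
rewrite -{2}(setD1K eF) -setUA; exact: kappa_add.
Qed.

Lemma card_kappa E : (n <= #|E| + kappa E)%N.
Proof. by have := kappa_addU set0 E; rewrite kappa0 setU0 addnC. Qed.

(** Forests are encoded by counting: they are the equality case of [card_kappa]. Cycles come back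
    only in [forest_acyclic]. *)
Definition forest F := (#|F| + kappa F == n)%N.

Lemma forest0 : forest set0.
Proof. by rewrite /forest cards0 kappa0. Qed.

Lemma forest_add F e a b : val e = [set a; b] -> ~~ connect (adj F) a b ->
  forest F -> forest (e |: F).
Proof.
move=> ve nab; rewrite /forest => /eqP fF.
have eF : e \notin F.
  by apply: contra nab => eF; apply: connect1; apply/adjP; exists e.
have := kappa_add_lt ve nab; have := card_kappa (e |: F).
by rewrite cardsU1 eF; lia.
Qed.

(** Edges of [G] joining two components of the current forest are added until none is left. This is
    both the step of Kruskal's algorithm and the source of a spanning tree for a single
    component. *)
Lemma forest_extend F G : forest F -> F \subset G ->
  exists F', [/\ forest F', F \subset F', F' \subset G &
    forall u v, connect (adj G) u v = connect (adj F') u v].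
Proof.
have [m] := ubnP #|G :\: F|; elim: m F => // m IH F Gm fF sFG.
have [/existsP[e /andP[eG /existsP[a /existsP[b /andP[/eqP ve nab]]]]]|] :=
  boolP [exists e in G, exists a, exists b,
    (val e == [set a; b]) && ~~ connect (adj F) a b].
  have eF : e \notin F.
    by apply: contra nab => eF; apply: connect1; apply/adjP; exists e.
  have [|||F' [fF' sFF' sFG' c]] := IH (e |: F).
  - rewrite (@leq_trans #|G :\: F|) //.
    apply: proper_card; apply/properP; split; first by apply: setDS; exact: subsetUr.
    by exists e; rewrite !inE ?eqxx // eF.
  - exact: forest_add nab fF.
  - by rewrite subUset sub1set eG.
  exists F'; split=> //; exact: subset_trans (subset_add _ _) sFF'.
rewrite negb_exists => /forallP H; exists F; split=> // u v.
apply/idP/idP; last exact: connect_subset.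
apply: connect_sub => {u v} u v /adjP[e eG ve].
move: (H e); rewrite eG /= negb_exists => /forallP/(_ u).
rewrite negb_exists => /forallP/(_ v).
by rewrite ve eqxx /= negbK.
Qed.

Lemma connected_kappa E : (0 < n)%N -> connected_graph E <-> (kappa E <= 1)%N.
Proof.
move=> n0; split=> [cE|k1 u v].
  rewrite /kappa; have -> : comps E = [set component E (Ordinal n0)].
    apply/setP => S; rewrite inE; apply/compsP/eqP => [[v ->]|->]; last by eexists.
    by apply/eqP; rewrite eq_componentE.
  by rewrite cards1.
by rewrite -eq_componentE; apply/eqP; apply: (card_le1_eqP k1); exact: component_in.
Qed.

(** Deleting the edge [ab] of a cycle keeps the graph connected, since the rest of the cycle joins
    [b] to [a]. But then at most [n - 2] edges connect [n] vertices, against [card_kappa]. *)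
Lemma forest_acyclic T : (0 < n)%N -> forest T -> connected_graph T -> acyclic T.
Proof.
move=> n0 fT cT [|a [|b [|c s]]] //= _ /andP[/= /andP[ab]].
rewrite rcons_path => /and3P[bc cs sa].
rewrite !inE !negb_or => /and3P[/and3P[nab nac nas] /andP[nbc nbs] us].
have /adjP[e eT ve] := ab.
have step x y : adj T x y -> [set x; y] != [set a; b] -> adj (T :\ e) x y.
  move=> /adjP[e' e'T ve'] ne; apply/adjP; exists e' => //; rewrite !inE e'T andbT.
  by apply: contra ne => /eqP ee; rewrite -ve' -ve ee.
have ba : connect (adj (T :\ e)) b a.
  have nba x y : x != a -> y != a -> [set x; y] != [set a; b].
    move=> xa ya; apply/eqP => /setP/(_ a); rewrite !inE eqxx /=.
    by rewrite ![a == _]eq_sym (negbTE xa) (negbTE ya).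
  have bc' : connect (adj (T :\ e)) b c.
    by apply: connect1; apply: step bc (nba _ _ _ _); rewrite eq_sym.
  (* This stretch of the cycle avoids the vertex [a], so none of its edges is [e]. *)
  have ls : connect (adj (T :\ e)) c (last c s).
    apply/connectP; exists s => //.
    apply: (@sub_in_path _ (fun x => x != a) (adj T)) cs.
      by move=> x y xa ya xy; apply: step xy (nba _ _ xa ya).
    rewrite /= eq_sym nac; apply/allP => x xs; apply: contraNneq nas => <-; exact: xs.
  have lb : last c s != b.
    have := mem_last c s; rewrite inE => /orP[/eqP->|ls']; first by rewrite eq_sym.
    by apply: contraNneq nbs => <-.
  have la : adj (T :\ e) (last c s) a.
    apply: step sa _; apply/eqP => /setP/(_ b).
    by rewrite !inE eqxx orbT ![b == _]eq_sym (negbTE lb) (negbTE nab).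
  by apply: connect_trans bc' (connect_trans ls _); exact: connect1.
have cT' : connected_graph (T :\ e).
  move=> u v; have := cT u v; rewrite -{1}(setD1K eT).
  move/(connect_add ve) => [//|[H1 H2]|[H1 H2]].
  - by apply: connect_trans H1 _; apply: connect_trans H2; rewrite connectC.
  - by apply: connect_trans H1 _; apply: connect_trans H2.
have := card_kappa (T :\ e); move/(connected_kappa _ n0): cT'.
move: fT (kappa_gt0 T n0); rewrite /forest (cardsD1 e) eT => /eqP.
by clear; lia.
Qed.

Lemma eq_connect_kappa E F :
  (forall u v, connect (adj E) u v = connect (adj F) u v) -> kappa E = kappa F.
Proof.
move=> H; rewrite /kappa /comps; congr #|pred_of_set _|; apply: eq_imset => v.
by apply/setP => u; rewrite !inE H.
Qed.

(** The lower half of Kruskal's formula: the edges of [T] outside [G] must connect all the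
    components of [G], and each of them removes at most one. *)
Lemma card_setD_kappa T G : (0 < n)%N -> connected_graph T ->
  (kappa G <= #|T :\: G|.+1)%N.
Proof.
move=> n0 /(connected_kappa _ n0) k1; have := kappa_addU G (T :\: G).
have : (kappa (T :\: G :|: G) <= kappa T)%N; last lia.
apply: kappa_sub; apply/subsetP => e eT; rewrite !inE eT andbT.
by case: (e \in G).
Qed.

(** Kruskal's algorithm in bulk: a maximal forest of each graph is extended to a maximal forest of
    the next. The final tree thus has at least [n - kappa (G j)] of its [n - 1] edges in [G j]. *)
Lemma kruskal_chain (G : nat -> {set edge n}) N : (0 < n)%N ->
  (forall i j, (i <= j)%N -> G i \subset G j) -> connected_graph (G N) ->
  exists T, [/\ spanning_tree T, T \subset G N &
    forall j, (j <= N)%N -> (#|T :\: G j| < kappa (G j))%N].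
Proof.
move=> n0 mG cG.
have [F [fF FG cF Fj]] : exists F, [/\ forest F, F \subset G N,
    forall u v, connect (adj (G N)) u v = connect (adj F) u v &
    forall j, (j <= N)%N -> (n <= #|F :&: G j| + kappa (G j))%N].
  elim: N {cG} => [|N [F [fF FG cF Fj]]].
    have [F [fF _ FG cF]] := forest_extend forest0 (sub0set (G 0)).
    exists F; split=> // j; rewrite leqn0 => /eqP->.
    by rewrite (setIidPl FG) (eq_connect_kappa cF) (eqP fF).
  have [F' [fF' FF' FG' cF']] := forest_extend fF (subset_trans FG (mG _ _ (leqnSn N))).
  exists F'; split=> // j; rewrite leq_eqVlt => /orP[/eqP->|].
    by rewrite (setIidPl FG') (eq_connect_kappa cF') (eqP fF').
  rewrite ltnS => /Fj H; apply: leq_trans H _; rewrite leq_add2r.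
  by apply: subset_leq_card; apply: setSI.
have cT : connected_graph F by move=> u v; rewrite -cF; exact: cG.
exists F; split=> // [|j jN].
  by split=> //; exact: forest_acyclic.
have := Fj _ jN; have := cardsID (G j) F; move: fF; rewrite /forest => /eqP.
have /(connected_kappa _ n0) := cT; have := kappa_gt0 F n0; lia.
Qed.
End graph.

(** * Trees on the vertex set of a component *)

Section trees.
Variable n : nat.
Implicit Types (E F G T A B : {set edge n}) (e : edge n) (u v w a b : 'I_n).
Implicit Types (S : {set 'I_n}).

Definition inside S : {set edge n} := [set e : edge n | (val e : {set 'I_n}) \subset S].
Definition touch S : {set edge n} := [set e : edge n | (val e : {set 'I_n}) :&: S != set0].
Definition cut S : {set edge n} := touch S :\: inside S.

(** Connectedness together with the number of edges characterises trees, and both are preserved by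
    an injective relabelling. The empty [S] has no tree, because [#|A|.+1] is positive. *)
Definition trees S : {set {set edge n}} :=
  [set A : {set edge n} | [&& A \subset inside S, #|A|.+1 == #|S| &
    [forall u in S, forall v in S, connect (adj A) u v]]].

Lemma treesP S A : reflect [/\ A \subset inside S, #|A|.+1 = #|S| &
    forall u v, u \in S -> v \in S -> connect (adj A) u v] (A \in trees S).
Proof.
rewrite inE; apply: (iffP and3P) => -[H1 H2 H3]; split=> //; try exact/eqP.
  by move=> u v uS vS; move/forallP/(_ u)/implyP/(_ uS)/forallP/(_ v)/implyP/(_ vS): H3.
by apply/forallP => u; apply/implyP => uS; apply/forallP => v; apply/implyP => vS; exact: H3.
Qed.

Lemma set2_touch e u v S : val e = [set u; v] -> u \in S -> e \in touch S.
Proof.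
by move=> ve uS; rewrite inE; apply/set0Pn; exists u; rewrite !inE ve !inE eqxx uS.
Qed.

Lemma component_cut E v : [disjoint cut (component E v) & E].
Proof.
rewrite disjoint_subset; apply/subsetP => e; rewrite !inE => /andP[ni /set0Pn[a]].
rewrite !inE => /andP[ae va]; apply: contra ni => eE.
apply/subsetP => b be; rewrite inE.
have [->//|ab] := eqVneq b a; apply: connect_trans va _; apply: connect1; apply/adjP.
exists e => //; apply/eqP; rewrite eq_sym eqEcard (eqP (valP e)) cards2 eq_sym ab.
by rewrite subUset !sub1set ae be.
Qed.

Lemma component_inside E v u : connect (adj E) v u ->
  connect (adj (E :&: inside (component E v))) v u.
Proof.
move=> vu; suff [] : connect (adj E) v u /\
  connect (adj (E :&: inside (component E v))) v u by [].
move: u vu; apply: connect_ind_l => // a b [va va'] ab; split.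
  by apply: connect_trans va _; exact: connect1.
apply: connect_trans va' _; apply: connect1; case/adjP: (ab) => e eE ve.
apply/adjP; exists e => //; rewrite !inE eE ve subUset !sub1set !inE va.
by apply: connect_trans va _; exact: connect1.
Qed.

(** All vertices outside the component become isolated. A maximal forest of this graph therefore has
    exactly one edge fewer than the component has vertices. *)
Lemma kappa_inside E v : kappa (E :&: inside (component E v)) = (n - #|component E v|).+1.
Proof.
set S := component E v; set G := _ :&: _.
have vS : v \in S by exact: component_refl.
have GS : G \subset inside S by exact: subsetIr.
have cS u w : u \in S -> connect (adj G) u w -> w \in S.
  move=> uS; move: w; apply: connect_ind_l => // a b aS /adjP[e eG ve].
  by have := subsetP GS _ eG; rewrite inE ve subUset !sub1set => /andP[].
have c1 u : u \in S -> component G u = S.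
  move=> uS; apply/setP => w; rewrite mem_component; apply/idP/idP; first exact: cS.
  move=> wS; apply: (@connect_trans _ _ v); last by apply: component_inside; rewrite inE in wS.
  by rewrite connectC; apply: component_inside; rewrite inE in uS.
have c2 u : u \notin S -> component G u = [set u].
  move=> uS; apply/setP => w; rewrite mem_component inE; apply/idP/eqP => [|->//].
  move: w; apply: connect_ind_l => // a b -> /adjP[e eG ve].
  have := subsetP GS _ eG; rewrite inE ve subUset !sub1set => /andP[uS'].
  by rewrite uS' in uS.
have -> : kappa G = #|S |: [set [set x] | x in ~: S]|.
  congr #|pred_of_set _|; apply/setP => C; rewrite !inE; apply/compsP/orP.
    move=> [u ->]; have [uS|uS] := boolP (u \in S); first by left; rewrite c1.
    by right; rewrite c2 //; apply: imset_f; rewrite inE.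
  move=> [/eqP->|/imsetP[x xS ->]]; first by exists v; rewrite c1.
  by exists x; rewrite c2 // -in_setC.
rewrite cardsU1 card_imset; last exact: set1_inj.
rewrite cardsCs setCK card_ord; case: imsetP => //= -[x xS Sx].
by move: xS; rewrite inE Sx inE eqxx.
Qed.

(** A necessary condition for being a component, to be used in a union bound over [A]; a component
    with cycles is then counted several times. *)
Lemma comps_tree E S : S \in comps E ->
  [disjoint cut S & E] /\ exists2 A, A \in trees S & A \subset E.
Proof.
move=> /compsP[v ->]; split; first exact: component_cut.
have [F [fF _ FG cF]] :=
  forest_extend (forest0 n) (sub0set (E :&: inside (component E v))).
exists F; last by apply: subset_trans FG _; exact: subsetIl.
apply/treesP; split.
- by apply: subset_trans FG _; exact: subsetIr.
- move: fF; rewrite /forest -(eq_connect_kappa cF) kappa_inside => /eqP.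
  have : #|component E v| <= n by rewrite -[X in _ <= X]card_ord max_card.
  by clear; lia.
- move=> a b; rewrite !inE -cF => va vb.
  apply: (@connect_trans _ _ v); last exact: component_inside.
  by rewrite connectC; exact: component_inside.
Qed.

(** A sufficient condition, whose events for different [A] are disjoint; it gives the lower bound by
    tree components alone. *)
Lemma tree_comps E S A : A \in trees S -> E :&: touch S = A -> S \in comps E.
Proof.
case/treesP => AS cA conA EA.
have /card_gt0P[v vS] : 0 < #|S| by rewrite -cA.
apply/compsP; exists v; apply/setP => u; rewrite mem_component; apply/idP/idP.
  by move=> uS; apply: connect_subset (conA _ _ vS uS); rewrite -EA subsetIl.
move: u; apply: connect_ind_l => // a b aS /adjP[e eE ve].
have : e \in A by rewrite -EA inE eE (set2_touch ve aS).
by move/(subsetP AS); rewrite inE ve subUset !sub1set => /andP[].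
Qed.

Lemma inside_touch S : inside S \subset touch S.
Proof.
apply/subsetP => e; rewrite !inE => /setIidPl ->.
by rewrite -card_gt0 (eqP (valP e)).
Qed.

Lemma card_cut S : #|S| * (n - #|S|) <= #|cut S|.
Proof.
have -> : n - #|S| = #|~: S| by rewrite [RHS]cardsCs setCK card_ord.
pose g (p : 'I_n * 'I_n) := [set p.1; p.2].
rewrite -cardsX -(@card_in_imset _ _ g).
  apply: leq_trans (leq_imset_card val (cut S)); apply: subset_leq_card.
  apply/subsetP => _ /imsetP[[x y] /setXP[/= xS yS] ->]; rewrite inE in yS.
  have xy : #|[set x; y]| == 2 by rewrite cards2; case: (x =P y) yS => // <-; rewrite xS.
  apply/imsetP; exists (exist _ [set x; y] xy) => //.
  rewrite !inE /= subUset !sub1set xS (negbTE yS) /=.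
  by apply/set0Pn; exists x; rewrite !inE eqxx.
move=> [x y] [x' y'] /setXP[/= xS yS] /setXP[/= xS' yS'] /setP gE.
rewrite !inE in yS yS'.
have := gE x; have := gE y; rewrite !inE !eqxx orbT /=.
move=> /esym/orP[/eqP yx|/eqP ->]; first by rewrite yx xS' in yS.
by move=> /esym/orP[/eqP -> //|/eqP xy]; rewrite -xy xS in yS'.
Qed.

Lemma card_touch S : #|touch S| <= #|S| * n.
Proof.
pose g (p : 'I_n * 'I_n) := [set p.1; p.2].
rewrite -[X in _ * X]card_ord -cardsT -cardsX -(card_imset _ (val_inj : injective (val : edge n -> _))).
apply: leq_trans (leq_imset_card g _); apply: subset_leq_card.
apply/subsetP => _ /imsetP[e eS ->]; move: eS; rewrite inE => /set0Pn[a].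
rewrite inE => /andP[ae aS]; have [x [y [xy ve]]] := edgeP e.
move: ae; rewrite ve !inE => /orP[]/eqP aE.
  by apply/imsetP; exists (x, y) => //; rewrite !inE -aE aS.
by apply/imsetP; exists (y, x); rewrite ?inE -?aE ?aS // /g /= setUC.
Qed.

Lemma sum_card_comps E : \sum_(S in comps E) #|S| = n.
Proof.
rewrite (eq_bigr (fun S : {set 'I_n} => \sum_(v in S) 1)); last by move=> S _; rewrite sum1_card.
rewrite (exchange_big_dep predT) //= -[RHS]card_ord -sum1_card; apply: eq_bigr => v _.
rewrite (big_pred1 (component E v)) // => S; apply/andP/eqP => [[/compsP[u ->]]|->].
  by rewrite mem_component => uv; apply/eqP; rewrite eq_componentE.
by rewrite component_in component_refl.
Qed.

(** The smaller of two components has at most half of the vertices, so each of its vertices accounts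
    for at least [n / 2] missing cut edges. *)
Lemma disconnected_cut E : (1 < kappa E) ->
  exists S, [/\ S != set0, #|S|.*2 <= n & [disjoint cut S & E]].
Proof.
move=> /card_gt1P[S1 [S2 [S1E S2E S12]]].
have S0 S : S \in comps E -> S != set0.
  by move=> /compsP[v ->]; apply/set0Pn; exists v; exact: component_refl.
have cS S : S \in comps E -> [disjoint cut S & E] by case/comps_tree.
have : #|S1| + #|S2| <= n.
  rewrite -[X in _ <= X](sum_card_comps E) (bigD1 S1) //= leq_add2l.
  by rewrite (bigD1 S2) /= ?leq_addr // S2E eq_sym.
have [le12|le21] := leqP #|S1| #|S2| => H.
- by exists S1; split; [exact: S0| rewrite -addnn; apply: leq_trans H; rewrite leq_add2l |exact: cS].
- exists S2; split; [exact: S0| |exact: cS].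
  by rewrite -addnn; apply: leq_trans H; rewrite leq_add2r ltnW.
Qed.

End trees.

Definition ntrees k : nat := #|trees [set: 'I_k]|.

(** * Relabelling trees along an injection of vertices *)

Section transport.
Variables (k n : nat) (phi : 'I_k -> 'I_n).
Hypothesis phi_inj : injective phi.

Let emap_proof (e : edge k) : #|phi @: val e| == 2.
Proof. by rewrite card_imset // (valP e). Qed.

Let emap (e : edge k) : edge n := exist _ (phi @: val e) (emap_proof e).

Let emap_inj : injective emap.
Proof. by move=> e e' [/(imset_inj phi_inj) ee]; apply: val_inj. Qed.

Let phi2 u v : phi @: [set u; v] = [set phi u; phi v].
Proof. by rewrite imsetU !imset_set1. Qed.

Let adj_emap (A : {set edge k}) u v : adj (emap @: A) (phi u) (phi v) = adj A u v.
Proof.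
apply/adjP/adjP => [[_ /imsetP[e eA ->] /= ve]|[e eA ve]].
  by exists e => //; apply: (imset_inj phi_inj); rewrite ve phi2.
by exists (emap e); [exact: imset_f|rewrite /= ve phi2].
Qed.

Let connect_emap (A : {set edge k}) u v :
  connect (adj (emap @: A)) (phi u) (phi v) = connect (adj A) u v.
Proof.
apply/idP/idP.
  move=> H; suff [w [/phi_inj -> //]] : exists w, phi v = phi w /\ connect (adj A) u w.
  move: (phi v) H; apply: connect_ind_l; first by exists u.
  move=> _ b [w [-> uw]] wb.
  have [w' bE] : exists w', b = phi w'.
    case/adjP: (wb) => _ /imsetP[e eA ->] /= /setP/(_ b); rewrite !inE eqxx orbT.
    by case/imsetP => w' _ ->; exists w'.
  exists w'; split=> //; apply: connect_trans uw _; apply: connect1.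
  by rewrite -adj_emap -bE.
move: v; apply: connect_ind_l => // a b ua ab.
by apply: connect_trans ua _; apply: connect1; rewrite adj_emap.
Qed.

Lemma card_trees_imset : #|trees (phi @: [set: 'I_k])| = ntrees k.
Proof.
rewrite /ntrees -(card_imset (mem (trees _)) (imset_inj emap_inj)).
congr #|pred_of_set _|; apply/setP => B; apply/idP/imsetP.
  case/treesP => BS cB conB; pose A := emap @^-1: B.
  have BA : B = emap @: A.
    apply/setP => e; apply/idP/imsetP => [eB|[e' ]]; last by rewrite inE => ? ->.
    have [x [y [xy ve]]] := edgeP e.
    have := subsetP BS _ eB; rewrite inE ve subUset !sub1set.
    case/andP => /imsetP[u _ xu] /imsetP[v _ yv].
    have uv : #|[set u; v]| == 2.
      by rewrite cards2; move: xy; rewrite xu yv; case: (eqVneq u v) => // ->; rewrite eqxx.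
    have ee : e = emap (exist _ [set u; v] uv).
      by apply: val_inj; rewrite /= phi2 -xu -yv.
    by exists (exist _ [set u; v] uv) => //; rewrite inE -ee.
  exists A => //; apply/treesP; split.
  - by apply/subsetP => e _; rewrite inE subsetT.
  - by rewrite -(card_imset _ emap_inj) -BA cB card_imset.
  - by move=> u v _ _; rewrite -connect_emap -BA; apply: conB; apply: imset_f.
move=> [A /treesP[AS cA conA] ->]; apply/treesP; split.
- apply/subsetP => _ /imsetP[e _ ->]; rewrite inE /=; apply: imsetS; exact: subsetT.
- by rewrite !card_imset.
- move=> _ _ /imsetP[u _ ->] /imsetP[v _ ->]; by rewrite connect_emap; apply: conA; rewrite inE.
Qed.
End transport.

Lemma card_trees n (S : {set 'I_n}) : #|trees S| = ntrees #|S|.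
Proof.
rewrite -(@card_trees_imset _ _ _ (@enum_val_inj _ (mem S))).
congr #|pred_of_set (trees _)|; apply/setP => x; apply/idP/imsetP => [xS|[i _ ->]].
  by exists (enum_rank_in xS x); rewrite ?inE // enum_rankK_in.
exact: enum_valP.
Qed.

Lemma ntrees1 : 0 < ntrees 1.
Proof.
apply/card_gt0P; exists set0; apply/treesP; split; first exact: sub0set.
  by rewrite cards0 cardsT card_ord.
by move=> u v _ _; rewrite (ord1 u) (ord1 v).
Qed.

From mathcomp Require Import all_order all_algebra ring lra.
Import Order.TTheory GRing.Theory Num.Theory.
Local Open Scope ring_scope.

(** * Independent Bernoulli coordinates *)

Section bernoulli.
Variables (R : realFieldType) (I : finType).
Implicit Types (E A B C : {set I}) (h g : {set I} -> R) (p : R) (e : I).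

(** The product Bernoulli law as a finite weight, so that expectations are finite sums and need no
    measure theory. [prob_fiber] identifies it with the law of the threshold graph. *)
Definition wt p E : R := \prod_i (if i \in E then p else 1 - p).
Definition Ex p h : R := \sum_(E : {set I}) wt p E * h E.

Lemma wt_ge0 p E : 0 <= p <= 1 -> 0 <= wt p E.
Proof.
by move=> /andP[p0 p1]; apply: prodr_ge0 => i _; case: ifP => //; rewrite subr_ge0.
Qed.

Lemma Ex_prob p A B : [disjoint A & B] ->
  Ex p (fun E => ((A \subset E) && [disjoint B & E])%:R) =
  p ^+ #|A| * (1 - p) ^+ #|B|.
Proof.
move=> dAB.
(* Expanding the product of the [f i + g i] gives one term for each [E]; the zeros of [f] on [B] and
   of [g] on [A] delete the sets that meet [B] or do not contain [A]. *)
pose f i := if i \in B then 0 else p; pose g i := if i \in A then 0 else 1 - p.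
transitivity (\prod_i (f i + g i)).
  rewrite bigA_distr; apply: eq_bigr => E _.
  case: (boolP (_ && _)) => [/andP[AE BE]|].
    rewrite mulr1; apply: eq_bigr => i _; rewrite /f /g; case: ifPn => iE.
      by rewrite (disjointFl BE iE).
    by case: (boolP (i \in A)) => // /(subsetP AE); rewrite (negbTE iE).
  rewrite mulr0 negb_and => /orP[/subsetPn[i iA iE]|].
    by rewrite (bigD1 i) //= (negbTE iE) /g iA mul0r.
  rewrite disjoint_subset => /subsetPn[i iB]; rewrite inE negbK => iE.
  by rewrite (bigD1 i) //= iE /f iB mul0r.
rewrite (eq_bigr (fun i => (if i \in A then p else 1) * (if i \in B then 1 - p else 1))).
  by rewrite big_split /= -!big_mkcond /= !prodr_const.
move=> i _; rewrite /f /g; have [iA|iA] := boolP (i \in A).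
  by rewrite (disjointFr dAB iA) addr0 mulr1.
by rewrite mul1r; case: ifP => _; rewrite ?add0r // addrC subrK.
Qed.

Lemma sum_wt p : \sum_(E : {set I}) wt p E = 1.
Proof.
have := @Ex_prob p set0 set0; rewrite !cards0 !expr0 mulr1 => <-; last first.
  by rewrite disjoint_subset; apply/subsetP => i; rewrite inE.
apply: eq_bigr => E _; rewrite sub0set disjoint_subset.
have -> : (set0 : {set I}) \subset [predC E] by apply/subsetP => i; rewrite inE.
by rewrite mulr1.
Qed.

Lemma Ex_const p (c : R) : Ex p (fun=> c) = c.
Proof. by rewrite /Ex -mulr_suml sum_wt mul1r. Qed.

Lemma eq_Ex p h g : h =1 g -> Ex p h = Ex p g.
Proof. by move=> hg; apply: eq_bigr => E _; rewrite hg. Qed.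

Lemma Ex_le p h g : 0 <= p <= 1 -> (forall E, h E <= g E) -> Ex p h <= Ex p g.
Proof.
by move=> p01 hg; apply: ler_sum => E _; apply: ler_wpM2l => //; exact: wt_ge0.
Qed.

Lemma ExZ p (c : R) h : Ex p (fun E => c * h E) = c * Ex p h.
Proof. by rewrite /Ex big_distrr /=; apply: eq_bigr => E _; rewrite mulrCA. Qed.

Lemma ExD p h g : Ex p (fun E => h E + g E) = Ex p h + Ex p g.
Proof. by rewrite /Ex -big_split /=; apply: eq_bigr => E _; rewrite mulrDr. Qed.

Lemma Ex_sum p (J : Type) (r : seq J) (P : pred J) (h : J -> {set I} -> R) :
  Ex p (fun E => \sum_(j <- r | P j) h j E) = \sum_(j <- r | P j) Ex p (h j).
Proof.
rewrite /Ex exchange_big /=; apply: eq_bigr => E _.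
by rewrite big_distrr.
Qed.

Lemma Ex_eq p A C : A \subset C ->
  Ex p (fun E => (E :&: C == A)%:R) = p ^+ #|A| * (1 - p) ^+ #|C :\: A|.
Proof.
move=> AC; rewrite -Ex_prob; last first.
  by rewrite disjoint_subset; apply/subsetP => i iA; rewrite !inE iA.
apply: eq_Ex => E; congr ((nat_of_bool _)%:R); apply/eqP/andP.
  move=> <-; split; first exact: subsetIl.
  rewrite disjoint_subset; apply/subsetP => i; rewrite !inE.
  by case: (i \in E) => //; case: (i \in C).
move=> [AE]; rewrite disjoint_subset => /subsetP dE; apply/setP => i; rewrite inE.
apply/andP/idP => [[iE iC]|iA]; last by rewrite (subsetP AE) // (subsetP AC).
by have := dE i; rewrite !inE iE iC andbT; case: (i \in A) => // /(_ isT).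
Qed.

(** Conditional expectation given all coordinates other than [e]. *)
Definition avg p e h : {set I} -> R := fun E => p * h (e |: E) + (1 - p) * h (E :\ e).

Lemma Ex_avg p e h : Ex p (avg p e h) = Ex p h.
Proof.
pose w E := \prod_(i | i != e) (if i \in E then p else 1 - p).
have wtE E : wt p E = (if e \in E then p else 1 - p) * w E by rewrite /wt (bigD1 e).
have wU E : w (e |: E) = w E.
  by apply: eq_bigr => i ie; rewrite !inE (negbTE ie).
have wD E : w (E :\ e) = w E.
  by apply: eq_bigr => i ie; rewrite !inE ie.
have inU (f : {set I} -> R) : \sum_(E : {set I} | e \in E) f E = \sum_(E : {set I} | e \notin E) f (e |: E).
  rewrite (reindex_onto (fun E => e |: E) (fun E => E :\ e)) /=; last first.
    by move=> E eE; rewrite setD1K.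
  apply: eq_bigl => E; rewrite !inE eqxx /=; apply/eqP/idP => [<-|eE].
    by rewrite !inE eqxx.
  by rewrite setU1K.
rewrite /Ex (bigID (fun E : {set I} => e \in E)) /= inU -big_split /=.
rewrite [RHS](bigID (fun E : {set I} => e \in E)) /= inU -big_split /=.
apply: eq_bigr => E eE; rewrite !wtE !wU /avg !inE eqxx /= (negbTE eE).
have -> : e |: (e |: E) = e |: E by rewrite setUA setUid.
have -> : (e |: E) :\ e = E by rewrite setU1K.
have -> : E :\ e = E by apply/setP => i; rewrite !inE; case: eqP => // ->; rewrite (negbTE eE).
by ring.
Qed.

Definition favg p h (s : seq I) := foldr (avg p) h s.

Lemma Ex_favg p h s : Ex p (favg p h s) = Ex p h.
Proof. by elim: s => //= e s IH; rewrite Ex_avg. Qed.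

Lemma avg_free p e h E : avg p e h (e |: E) = avg p e h (E :\ e).
Proof.
rewrite /avg; congr (_ * h _ + _ * h _); apply/setP => i; rewrite !inE;
  by case: (i == e).
Qed.

Lemma favg_free p h s e E : e \in s -> favg p h s (e |: E) = favg p h s (E :\ e).
Proof.
elim: s E => //= e' s IH E; rewrite inE.
have [->|ne] := eqVneq e e'; first by rewrite avg_free.
move=> /= es; rewrite /avg.
have -> : e' |: (e |: E) = e |: (e' |: E) by rewrite setUCA.
have -> : (e |: E) :\ e' = e |: (E :\ e').
  by apply/setP => i; rewrite !inE; case: (i =P e) => // ->; rewrite ne.
have -> : e' |: (E :\ e) = (e' |: E) :\ e.
  by apply/setP => i; rewrite !inE; case: (i =P e) => // ->; rewrite (negbTE ne).
have -> : (E :\ e) :\ e' = (E :\ e') :\ e.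
  by apply/setP => i; rewrite !inE andbCA.
by rewrite !IH.
Qed.

(** Averaging over every coordinate leaves a constant. Inequalities between expectations can
    therefore be proved by induction on the list of coordinates, one Bernoulli variable at a
    time. *)
Lemma favg_enum p h E : favg p h (enum I) E = Ex p h.
Proof.
set g := favg _ _ _.
have gfree e F : g (e |: F) = g (F :\ e) by apply: favg_free; rewrite mem_enum.
have gE F : g F = g set0.
  have [m] := ubnP #|F|; elim: m F => // m IH F.
  have [->//|[e eF]] := set_0Vmem F.
  rewrite (cardsD1 e) eF add1n ltnS => Fm.
  by rewrite -{1}(setD1K eF) gfree IH // (leq_ltn_trans _ Fm) // subset_leq_card // subsetDl.
rewrite -(Ex_favg p h (enum I)) -/g gE (eq_Ex p gE) Ex_const //.
Qed.

(** The property of [kappa] behind both monotonicity in [p] and the variance bound. Comparing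
    [E :\ e] with [e |: E] avoids a case distinction on [e \in E]. *)
Definition unit_decr h := forall e E, 0 <= h (E :\ e) - h (e |: E) <= 1.

Lemma avg_unit_decr p e h : 0 <= p <= 1 -> unit_decr h -> unit_decr (avg p e h).
Proof.
move=> /andP[p0 p1] hh e' E; rewrite /avg.
have [<-|ne] := eqVneq e e'.
  have -> : e |: (E :\ e) = e |: (e |: E).
    by apply/setP => i; rewrite !inE; case: (i == e).
  have -> : E :\ e :\ e = (e |: E) :\ e.
    by apply/setP => i; rewrite !inE; case: (i == e).
  by rewrite subrr lexx ler01.
have -> : e |: (e' |: E) = e' |: (e |: E) by rewrite setUCA.
have -> : (e' |: E) :\ e = e' |: (E :\ e).
  by apply/setP => i; rewrite !inE; case: (i =P e') => // ->; rewrite eq_sym ne.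
have -> : e |: (E :\ e') = (e |: E) :\ e'.
  by apply/setP => i; rewrite !inE; case: (i =P e') => // ->; rewrite eq_sym (negbTE ne).
have -> : (E :\ e') :\ e = (E :\ e) :\ e'.
  by apply/setP => i; rewrite !inE andbCA.
have /andP[a0 a1] := hh e' (e |: E); have /andP[b0 b1] := hh e' (E :\ e).
apply/andP; split; nra.
Qed.

Lemma favg_unit_decr p h s : 0 <= p <= 1 -> unit_decr h -> unit_decr (favg p h s).
Proof. by move=> p01 hh; elim: s => //= e s IH; exact: avg_unit_decr. Qed.

(** In each coordinate, raising [p] moves weight from [E :\ e] to [e |: E], where the averaged
    function is smaller. *)
Lemma Ex_antitone p p' h : 0 <= p -> p <= p' -> p' <= 1 -> unit_decr h ->
  Ex p' h <= Ex p h.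
Proof.
move=> p0 pp' p1 hh; rewrite -(favg_enum p' h set0) -(favg_enum p h set0).
elim: (enum I) set0 => //= e s IH E; rewrite /avg.
have := IH (e |: E); have := IH (E :\ e).
have p01 : 0 <= p <= 1 by rewrite p0 (le_trans pp').
have /andP[] := favg_unit_decr s p01 hh e E.
set a := favg p h s _; set b := favg p h s _; set a' := favg p' h s _; set b' := favg p' h s _.
by move=> H _ H1 H2; nra.
Qed.

(* Efron-Stein: averaging over one coordinate turns the mean of the square into
   the square of the mean at the cost of a Bernoulli variance. *)
Lemma Ex_sq p h : 0 <= p <= 1 -> unit_decr h ->
  Ex p (fun E => h E ^+ 2) <= Ex p h ^+ 2 + #|I|%:R * (p * (1 - p)).
Proof.
move=> p01 hh; rewrite -(favg_enum p _ set0) -(favg_enum p h set0) cardE.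
have /andP[p0 p1] := p01.
elim: (enum I) set0 => [|e s IH] E /=; first by rewrite mul0r addr0.
rewrite /avg; have := IH (e |: E); have := IH (E :\ e).
have /andP[] := favg_unit_decr s p01 hh e E.
set a := favg p h s _; set b := favg p h s _; set a' := favg _ _ _ _; set b' := favg _ _ _ _.
rewrite -natr1; set K := (size s)%:R; set q := 1 - p.
have q0 : 0 <= q by rewrite subr_ge0.
move=> H0 H1 Ha Hb.
have H2 : (a - b) ^+ 2 <= 1 by rewrite expr2; nra.
have Hpa : q * a' <= q * (a ^+ 2 + K * (p * q)) by exact: ler_wpM2l.
have Hpb : p * b' <= p * (b ^+ 2 + K * (p * q)) by exact: ler_wpM2l.
apply: le_trans (lerD Hpb Hpa) _.
have Hpq : p * q * (a - b) ^+ 2 <= p * q by rewrite ler_piMr // mulr_ge0.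
rewrite -subr_ge0.
have -> : (p * b + q * a) ^+ 2 + (K + 1) * (p * q) -
   (p * (b ^+ 2 + K * (p * q)) + q * (a ^+ 2 + K * (p * q))) = p * q - p * q * (a - b) ^+ 2.
  by rewrite /q; ring.
by rewrite subr_ge0.
Qed.

Lemma Ex_var p h : 0 <= p <= 1 -> unit_decr h ->
  Ex p (fun E => (h E - Ex p h) ^+ 2) <= #|I|%:R * p.
Proof.
move=> p01 hh; set m := Ex p h.
have -> : Ex p (fun E => (h E - m) ^+ 2) = Ex p (fun E => h E ^+ 2) - m ^+ 2.
  rewrite (@eq_Ex _ _ (fun E => h E ^+ 2 + ((- 2 * m) * h E + m ^+ 2))); last by move=> E; ring.
  by rewrite ExD ExD ExZ Ex_const -/m; ring.
have := Ex_sq p01 hh; rewrite -/m => H.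
rewrite lerBlDl; apply: le_trans H _; rewrite lerD2l ler_wpM2l // ler_piMr //.
  by case/andP: p01.
by case/andP: p01 => p0 _; rewrite gerBl.
Qed.

(** From variance to mean absolute deviation by [2 a |z| <= z^2 + a^2]. *)
Lemma Ex_abs_dev p h (a : R) : 0 <= p <= 1 -> unit_decr h -> 0 < a ->
  #|I|%:R * p <= a ^+ 2 -> Ex p (fun E => `|h E - Ex p h|) <= a.
Proof.
move=> p01 hh a0 Ha; set m := Ex p h.
have : Ex p (fun E => (2 * a) * `|h E - m|) <= Ex p (fun E => (h E - m) ^+ 2 + a ^+ 2).
  apply: Ex_le => // E; rewrite -[X in _ <= X + _]real_normK ?num_real //.
  by rewrite -subr_ge0; have := sqr_ge0 (`|h E - m| - a); lra.
rewrite ExZ ExD Ex_const => H.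
have := Ex_var p01 hh; rewrite -/m => V.
rewrite -(ler_pM2l (_ : 0 < 2 * a)); last by lra.
apply: le_trans H _; apply: le_trans (lerD V (lexx _)) _.
apply: le_trans (lerD Ha (lexx _)) _; lra.
Qed.
End bernoulli.

(** * Expected numbers of components *)

Section components.
Variables (R : realFieldType) (n : nat).
Implicit Types (E A : {set edge n}) (S : {set 'I_n}) (p : R).

Lemma kappa_unit_decr : unit_decr (fun E : {set edge n} => (kappa E)%:R : R).
Proof.
move=> e E; have -> : e |: E = e |: (E :\ e).
  by apply/setP => i; rewrite !inE; case: (i == e).
have H1 := kappa_sub (subset_add (E :\ e) e); have H2 := kappa_add (E :\ e) e.
by rewrite subr_ge0 ler_nat H1 lerBlDl natr1 ler_nat.
Qed.

Definition ncomps k E : nat := (\sum_(S in comps E) (#|S| == k))%N.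

Lemma sum_ncomps (F : nat -> nat) K E :
  (\sum_(k < K) F k * ncomps k E = \sum_(S in comps E) F #|S| * (#|S| < K))%N.
Proof.
rewrite (eq_bigr (fun k : 'I_K => \sum_(S in comps E) F k * (#|S| == k)))%N; last first.
  by move=> k _; rewrite big_distrr.
rewrite exchange_big /=; apply: eq_bigr => S _.
have [SK|SK] := ltnP #|S| K.
  rewrite (bigD1 (Ordinal SK)) //= eqxx big1 ?addn0 // => k kS.
  by case: eqP => [Sk|]; rewrite ?muln0 //; case/eqP: kS; apply: val_inj.
rewrite muln0 big1 // => k _; case: eqP => [Sk|]; rewrite ?muln0 //.
by have := ltn_ord k; rewrite -Sk ltnNge SK.
Qed.

Lemma sum_ncomps_le_kappa K E : (\sum_(k < K) ncomps k E <= kappa E)%N.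
Proof.
rewrite (eq_bigr (fun k : 'I_K => 1 * ncomps k E)%N); last by move=> k _; rewrite mul1n.
rewrite (sum_ncomps (fun=> 1%N)) /kappa -sum1_card; apply: leq_sum => S _.
by rewrite mul1n leq_b1.
Qed.

Lemma sum_size_ncomps K E : (\sum_(k < K) k * ncomps k E <= n)%N.
Proof.
rewrite (sum_ncomps id) -[X in (_ <= X)%N](sum_card_comps E).
by apply: leq_sum => S _; rewrite -[X in (_ <= X)%N]muln1 leq_mul2l leq_b1 orbT.
Qed.

(** At most [n / K] components have [K] vertices or more; multiplying by [K] keeps the inequality
    within the natural numbers. *)
Lemma kappa_le_sum_ncomps K E :
  (K * kappa E <= K * (\sum_(k < K) ncomps k E) + n)%N.
Proof.
rewrite (eq_bigr (fun k : 'I_K => 1 * ncomps k E)%N); last by move=> k _; rewrite mul1n.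
rewrite (sum_ncomps (fun=> 1%N)) -[X in (_ <= _ + X)%N](sum_card_comps E).
rewrite /kappa -sum1_card !big_distrr -big_split /=; apply: leq_sum => S _.
by case: (ltnP #|S| K) => /= H; lia.
Qed.

Lemma ncomps_sets k E :
  (ncomps k E = \sum_(S : {set 'I_n} | #|S| == k) (S \in comps E))%N.
Proof.
rewrite /ncomps big_mkcond [RHS]big_mkcond; apply: eq_bigr => S _.
by case: (S \in _); case: (_ == _).
Qed.

Lemma sum_sets_card k (x : R) :
  \sum_(S : {set 'I_n} | #|S| == k) x = 'C(n, k)%:R * x.
Proof.
have -> : 'C(n, k) = #|[pred S : {set 'I_n} | #|S| == k]|.
  by rewrite -[in LHS](card_ord n) -card_draws; apply: eq_card => S; rewrite !inE.
by rewrite sumr_const mulr_natl.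
Qed.

(** Union bound over the vertex sets [S] and their trees, by [comps_tree]: the [k - 1] tree edges
    are present and the cut edges absent. *)
Lemma Ex_ncomps_le p k : 0 <= p <= 1 ->
  Ex p (fun E => (ncomps k E)%:R : R) <=
  'C(n, k)%:R * ((ntrees k)%:R * (p ^+ k.-1 * (1 - p) ^+ (k * (n - k)))).
Proof.
move=> p01; have /andP[p0 p1] := p01.
rewrite -sum_sets_card.
have -> : Ex p (fun E => (ncomps k E)%:R : R) =
    \sum_(S : {set 'I_n} | #|S| == k) Ex p (fun E => (S \in comps E)%:R).
  by rewrite -Ex_sum; apply: eq_Ex => E; rewrite ncomps_sets natr_sum.
apply: ler_sum => S /eqP Sk.
apply: (@le_trans _ _ (\sum_(A in trees S)
    Ex p (fun E => ((A \subset E) && [disjoint cut S & E])%:R))).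
  rewrite -Ex_sum; apply: Ex_le => // E.
  case: (boolP (S \in comps E)) => [/comps_tree[dE [A AS AE]]|_]; last first.
    by apply: sumr_ge0.
  by rewrite (bigD1 A) //= AE dE lerDl; apply: sumr_ge0.
rewrite -Sk -card_trees mulr_natl -sumr_const; apply: ler_sum => A /treesP[AS cA _].
rewrite Ex_prob.
  by rewrite -cA /= ler_wpM2l ?exprn_ge0 // ler_wiXn2l ?subr_ge0 ?gerBl // cA card_cut.
rewrite disjoint_subset; apply/subsetP => e /(subsetP AS).
by rewrite !inE => ->.
Qed.

(** Only isolated trees are counted, by [tree_comps]. The exponent [k * (n - k)] of the upper bound
    becomes [k * n]; for [p = c / n] the two bounds are close as long as [c k^2] is small against
    [n]. *)
Lemma Ex_ncomps_ge p k : 0 <= p <= 1 ->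
  'C(n, k)%:R * ((ntrees k)%:R * (p ^+ k.-1 * (1 - p) ^+ (k * n))) <=
  Ex p (fun E => (ncomps k E)%:R : R).
Proof.
move=> p01; have /andP[p0 p1] := p01.
rewrite -sum_sets_card.
have -> : Ex p (fun E => (ncomps k E)%:R : R) =
    \sum_(S : {set 'I_n} | #|S| == k) Ex p (fun E => (S \in comps E)%:R).
  by rewrite -Ex_sum; apply: eq_Ex => E; rewrite ncomps_sets natr_sum.
apply: ler_sum => S /eqP Sk.
apply: (@le_trans _ _ (\sum_(A in trees S) Ex p (fun E => (E :&: touch S == A)%:R))).
  rewrite -Sk -card_trees mulr_natl -sumr_const; apply: ler_sum => A /treesP[AS cA _].
  have AT := subset_trans AS (inside_touch S).
  rewrite Ex_eq // -cA /= ler_wpM2l ?exprn_ge0 // ler_wiXn2l ?subr_ge0 ?gerBl //.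
  rewrite cA (leq_trans (subset_leq_card (subsetDl _ _))) // card_touch //.
rewrite -Ex_sum; apply: Ex_le => // E.
case: (boolP (S \in comps E)) => SE.
  rewrite -natr_sum ler_nat (@leq_trans (\sum_(A : {set edge n}) (E :&: touch S == A))%N) //.
    by rewrite [X in (_ <= X)%N](bigID (mem (trees S))) /= leq_addr.
  by rewrite (bigD1 (E :&: touch S)) //= eqxx big1 // => A; rewrite eq_sym => /negbTE->.
rewrite big1 // => A AS; case: eqP => // EA.
by rewrite (tree_comps AS EA) in SE.
Qed.

(** Union bound over the small sides [S] of an empty cut. Each has probability at most [y ^+ #|S|],
    and the sum of these powers over all nonempty [S] is the right-hand side. *)
Lemma Ex_disconnected p (y : R) : 0 <= p <= 1 ->
  (forall m, (n <= m.*2)%N -> (1 - p) ^+ m <= y) ->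
  Ex p (fun E => (1 < kappa E)%N%:R) <= (1 + y) ^+ n - 1.
Proof.
move=> p01 Hy; have /andP[p0 p1] := p01.
have y0 : 0 <= y.
  by apply: le_trans (Hy n _); rewrite ?exprn_ge0 ?subr_ge0 // -addnn leq_addr.
have -> : (1 + y) ^+ n - 1 = \sum_(S : {set 'I_n} | S != set0) y ^+ #|S|.
  have -> : (1 + y) ^+ n = \sum_(S : {set 'I_n}) y ^+ #|S|.
    rewrite -[in LHS](card_ord n) -prodr_const.
    rewrite (eq_bigr (fun=> y + 1)); last by move=> *; rewrite addrC.
    rewrite bigA_distr; apply: eq_bigr => S _.
    by rewrite -big_mkcond /= prodr_const.
  by rewrite (bigD1 set0) //= cards0 expr0 addrAC subrr add0r.
apply: (@le_trans _ _ (\sum_(S : {set 'I_n} | (S != set0) && (#|S|.*2 <= n)%N)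
    Ex p (fun E => ((set0 \subset E) && [disjoint cut S & E])%:R))).
  rewrite -Ex_sum; apply: Ex_le => // E.
  have [/disconnected_cut[S [S0 Sn dS]]|_] := ltnP 1 (kappa E); last exact: sumr_ge0.
  by rewrite (bigD1 S) ?S0 //= sub0set dS lerDl; apply: sumr_ge0.
rewrite [X in _ <= X](bigID (fun S : {set 'I_n} => (#|S|.*2 <= n)%N)) /=.
rewrite -[X in X <= _]addr0; apply: lerD; last by apply: sumr_ge0 => S _; rewrite exprn_ge0.
apply: ler_sum => S /andP[S0 Sn]; rewrite Ex_prob; last first.
  by rewrite disjoint_subset; apply/subsetP => i; rewrite inE.
rewrite cards0 expr0 mul1r.
apply: (@le_trans _ _ ((1 - p) ^+ (#|S| * (n - #|S|)))).
  by rewrite ler_wiXn2l ?subr_ge0 ?gerBl // card_cut.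
rewrite mulnC exprM lerXn2r ?nnegrE ?exprn_ge0 ?subr_ge0 //.
apply: Hy; move: Sn; clear.
move: #|S| => k; lia.
Qed.
End components.

From mathcomp Require Import all_classical all_reals all_analysis measurable_realfun.
Import numFieldNormedType.Exports.
Local Open Scope classical_set_scope.
Local Open Scope ring_scope.

(** * The limiting component density *)

Section limit_density.
Variable R : realType.
Implicit Types (c x : R) (n k K : nat).

(** At [k = 0], where [k.-1] is also [0], the factor [ntrees 0 = 0] removes the term. *)
Definition density_term k c : R := (ntrees k)%:R * c ^+ k.-1 * expR (- (k%:R * c)) / k`!%:R.

Definition mean_ncomps n k c : R :=
  Ex (c / n%:R) (fun E : {set edge n} => (ncomps k E)%:R) / n%:R.

Definition mean_kappa n c : R :=
  Ex (c / n%:R) (fun E : {set edge n} => (kappa E)%:R) / n%:R.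

Lemma ntrees0 : ntrees 0 = 0%N.
Proof.
apply: eq_card0 => A; apply/negbTE/negP => /treesP[_ + _].
by rewrite cardsT card_ord.
Qed.

Lemma fk_ge0 k c : 0 <= c -> 0 <= density_term k c.
Proof.
by move=> c0; rewrite /density_term !mulr_ge0 ?expR_ge0 ?invr_ge0 ?exprn_ge0.
Qed.

Lemma edge_prob_itv n c : (0 < n)%N -> 0 <= c <= n%:R -> 0 <= c / n%:R <= 1.
Proof.
move=> n0 /andP[c0 cn]; rewrite divr_ge0 //= ler_pdivrMr ?ltr0n // mul1r //.
Qed.

Lemma mean_ncomps_ge0 n k c : (0 < n)%N -> 0 <= c <= n%:R -> 0 <= mean_ncomps n k c.
Proof.
move=> n0 cn; rewrite divr_ge0 //; apply: sumr_ge0 => E _.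
by rewrite mulr_ge0 // wt_ge0 // edge_prob_itv.
Qed.

Lemma ffact_le_exp n k : (n ^_ k <= n ^ k)%N.
Proof.
elim: k => [|k IH]; first by rewrite ffactn0.
by rewrite ffactnSr expnSr leq_mul // leq_subr.
Qed.

Lemma ffact_ge_exp n k : (0 < n)%N ->
  n%:R ^+ k * (1 - (k%:R ^+ 2) / n%:R) <= (n ^_ k)%:R :> R.
Proof.
move=> n0; have n0R : 0 < n%:R :> R by rewrite ltr0n.
elim: k => [|k IH]; first by rewrite ffactn0 expr0 expr0n /= mul0r subr0 mul1r.
(* For [n <= k] the falling factorial of order [k.+1] vanishes and the factor on the left is not
   positive. *)
have [nk|kn] := leqP n k.
  rewrite ffactnSr (eqP (_ : (n - k)%N == 0%N)) ?subn_eq0 // muln0.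
  rewrite pmulr_rle0 ?exprn_gt0 // subr_le0 ler_pdivlMr // mul1r -natrX ler_nat.
  by rewrite (leq_trans nk) // (leq_trans (leqnSn k)) // leq_pmull.
rewrite ffactnSr natrM natrB ?(ltnW kn) //.
have nk0 : 0 <= n%:R - k%:R :> R by rewrite subr_ge0 ler_nat ltnW.
apply: le_trans (ler_wpM2r nk0 IH).
have -> : n%:R ^+ k * (1 - k%:R ^+ 2 / n%:R) * (n%:R - k%:R) =
  n%:R ^+ k.+1 * ((1 - k%:R ^+ 2 / n%:R) * (1 - k%:R / n%:R)) :> R.
  by rewrite [n%:R ^+ k.+1]exprSr; field; rewrite gt_eqF.
rewrite ler_wpM2l ?exprn_ge0 //.
set a := n%:R^-1 : R; have a0 : 0 <= a by rewrite invr_ge0 ltW.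
have k0 : 0 <= k%:R :> R by [].
have : 0 <= k%:R ^+ 3 * a ^+ 2 :> R by rewrite mulr_ge0 ?exprn_ge0.
have : 0 <= k%:R * a by rewrite mulr_ge0.
rewrite -natr1; set K := k%:R; move=> H1 H2.
rewrite -subr_ge0.
have -> : (1 - K ^+ 2 * a) * (1 - K * a) - (1 - (K + 1) ^+ 2 * a) = K ^+ 3 * a ^+ 2 + K * a + a.
  by ring.
by rewrite !addr_ge0.
Qed.

Lemma bernoulli_ineq x (N : nat) : 0 <= x <= 1 -> 1 - N%:R * x <= (1 - x) ^+ N.
Proof.
move=> /andP[x0 x1]; elim: N => [|N IH]; first by rewrite mul0r subr0 expr0.
have x1' : 0 <= 1 - x by rewrite subr_ge0.
rewrite exprS -natr1; apply: le_trans (ler_wpM2l x1' IH).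
have : 0 <= N%:R * x ^+ 2 by rewrite mulr_ge0 ?exprn_ge0.
by lra.
Qed.

Lemma onem_le_exp x (N : nat) : x <= 1 -> (1 - x) ^+ N <= expR (- (N%:R * x)).
Proof.
move=> x1; rewrite -mulrN expRM_natl lerXn2r ?nnegrE ?expR_ge0 ?subr_ge0 //.
exact: expR_ge1Dx.
Qed.

(** From [1 - x^2 = (1 - x) (1 + x) <= (1 - x) e^x], raised to the power [N] and combined with
    Bernoulli's inequality. *)
Lemma onem_ge_exp x (N : nat) : 0 <= x <= 1 ->
  expR (- (N%:R * x)) * (1 - N%:R * x ^+ 2) <= (1 - x) ^+ N.
Proof.
move=> /andP[x0 x1].
have x2 : 0 <= x ^+ 2 <= 1 by rewrite exprn_ge0 //= exprn_ile1.
apply: le_trans (ler_wpM2l (expR_ge0 _) (bernoulli_ineq N x2)) _.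
rewrite -mulrN expRM_natl -exprMn lerXn2r ?nnegrE ?mulr_ge0 ?expR_ge0 ?subr_ge0 //.
  by case/andP: x2.
have -> : 1 - x ^+ 2 = (1 - x) * (1 + x) by ring.
rewrite mulrCA ler_piMr ?subr_ge0 // expRN mulrC ler_pdivrMr ?expR_gt0 // mul1r.
exact: expR_ge1Dx.
Qed.

(** The correction multiplies [mean_ncomps], so that for [k <= r] its cost is at most [c r / n]
    times [k * mean_ncomps n k c], and these are summed by [sum_mean_ncomps]. In [mean_ncomps_ge] it
    sits on [density_term], to be summed by [sum_size_fk]. *)
Lemma mean_ncomps_le n k c : (0 < n)%N -> 0 <= c <= n%:R ->
  mean_ncomps n k c * (1 - c * k%:R ^+ 2 / n%:R) <= density_term k c.
Proof.
move=> n0 cn; have n0R : 0 < n%:R :> R by rewrite ltr0n.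
have /andP[c0 cn'] := cn; have P01 := edge_prob_itv n0 cn; have /andP[P0 P1] := P01.
have N0 := mean_ncomps_ge0 k n0 cn.
set x := c * k%:R ^+ 2 / n%:R.
apply: (@le_trans _ _ (mean_ncomps n k c * expR (- x))).
  by rewrite ler_wpM2l // expR_ge1Dx.
have H := Ex_ncomps_le n k P01.
have U : mean_ncomps n k c <= 'C(n, k)%:R * ((ntrees k)%:R *
  ((c / n%:R) ^+ k.-1 * (1 - c / n%:R) ^+ (k * (n - k)))) / n%:R.
  by rewrite ler_pM2r ?invr_gt0.
case: k @x H U N0 => [|k] x H U N0.
  rewrite ntrees0 mul0r mulr0 mul0r in U.
  have -> : mean_ncomps n 0 c = 0 by apply/eqP; rewrite eq_le U N0.
  by rewrite mul0r fk_ge0.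
have [nk|kn] := ltnP n k.+1.
  rewrite bin_small // !mul0r in U.
  have -> : mean_ncomps n k.+1 c = 0 by apply/eqP; rewrite eq_le U N0.
  by rewrite mul0r fk_ge0.
apply: le_trans (ler_wpM2r (expR_ge0 _) U) _.
have V : (1 - c / n%:R) ^+ (k.+1 * (n - k.+1)) <= expR (- (k.+1%:R * c) + x).
  apply: le_trans (onem_le_exp _ P1) _; rewrite ler_expR natrM natrB // /x.
  by rewrite le_eqVlt; apply/orP; left; apply/eqP; field; rewrite gt_eqF.
have B : 'C(n, k.+1)%:R <= n%:R ^+ k.+1 / k.+1`!%:R :> R.
  by rewrite ler_pdivlMr ?ltr0n ?fact_gt0 // -natrM -natrX ler_nat bin_ffact ffact_le_exp.
apply: (@le_trans _ _ ((n%:R ^+ k.+1 / k.+1`!%:R) * ((ntrees k.+1)%:R *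
  ((c / n%:R) ^+ k * expR (- (k.+1%:R * c) + x))) / n%:R * expR (- x))).
  rewrite ler_wpM2r ?expR_ge0 // ler_wpM2r ?invr_ge0 ?(ltW n0R) //.
  rewrite ler_pM ?mulr_ge0 ?exprn_ge0 ?subr_ge0 //.
  by rewrite ler_wpM2l // ler_wpM2l ?exprn_ge0.
rewrite expRD /density_term /= !exprMn exprVn exprS.
rewrite le_eqVlt; apply/orP; left; apply/eqP.
rewrite -[RHS]mulr1 -[X in _ = _ * X](divff (_ : expR x != 0)) ?gt_eqF ?expR_gt0 // -expRN.
by field; rewrite !gt_eqF ?exprn_gt0 // ltr0n fact_gt0.
Qed.

Lemma mean_ncomps_ge n k c : (0 < n)%N -> 0 <= c <= n%:R ->
  density_term k c * (1 - (k%:R ^+ 2 + k%:R * c ^+ 2) / n%:R) <= mean_ncomps n k c.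
Proof.
move=> n0 cn; have n0R : 0 < n%:R :> R by rewrite ltr0n.
have /andP[c0 cn'] := cn; have P01 := edge_prob_itv n0 cn; have /andP[P0 P1] := P01.
have N0 := mean_ncomps_ge0 k n0 cn.
case: k N0 => [|k] N0; first by rewrite /density_term ntrees0 !mul0r.
have U : 'C(n, k.+1)%:R * ((ntrees k.+1)%:R *
  ((c / n%:R) ^+ k * (1 - c / n%:R) ^+ (k.+1 * n))) / n%:R <= mean_ncomps n k.+1 c.
  by rewrite ler_pM2r ?invr_gt0 // (Ex_ncomps_ge n k.+1 P01).
apply: le_trans U.
have := ffact_ge_exp k.+1 n0; rewrite -bin_ffact natrM.
set b := 'C(n, k.+1)%:R; set F := k.+1`!%:R => HF.
have F0 : 0 < F by rewrite ltr0n fact_gt0.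
have V := onem_ge_exp (k.+1 * n) P01.
set e1 := (1 - c / n%:R) ^+ (k.+1 * n) in V *.
have e10 : 0 <= e1 by rewrite exprn_ge0 // subr_ge0.
have EE : - ((k.+1 * n)%:R * (c / n%:R)) = - (k.+1%:R * c).
  by rewrite natrM; field; rewrite gt_eqF.
have EE2 : (k.+1 * n)%:R * (c / n%:R) ^+ 2 = k.+1%:R * c ^+ 2 / n%:R.
  by rewrite natrM; field; rewrite gt_eqF.
rewrite EE EE2 in V; set e2 := expR _ in V.
have e20 : 0 < e2 by exact: expR_gt0.
set al := 1 - k.+1%:R ^+ 2 / n%:R in HF; set be := 1 - k.+1%:R * c ^+ 2 / n%:R in V.
have al1 : al <= 1 by rewrite gerBl divr_ge0 ?exprn_ge0.
have be1 : be <= 1 by rewrite gerBl divr_ge0 ?mulr_ge0 ?exprn_ge0.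
have -> : 1 - (k.+1%:R ^+ 2 + k.+1%:R * c ^+ 2) / n%:R = al + be - 1.
  by rewrite /al /be mulrDl; ring.
have nk0 : 0 < n%:R ^+ k.+1 :> R by rewrite exprn_gt0.
have b0 : 0 <= b by [].
(* Since [al] and [be] are at most 1, [al + be - 1 <= al * be]. If one of them is not positive, the
   left side is not positive either. *)
have key : e2 * n%:R ^+ k.+1 * (al + be - 1) <= b * F * e1.
  have rhs0 : 0 <= b * F * e1 by rewrite !mulr_ge0 // ltW.
  have [ale0|al0] := leP al 0.
    by apply: le_trans rhs0; rewrite pmulr_rle0 ?mulr_gt0 //; lra.
  have [bee0|be0] := leP be 0.
    by apply: le_trans rhs0; rewrite pmulr_rle0 ?mulr_gt0 //; lra.
  apply: (@le_trans _ _ ((n%:R ^+ k.+1 * al) * (e2 * be))).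
    have -> : n%:R ^+ k.+1 * al * (e2 * be) = e2 * n%:R ^+ k.+1 * (al * be) by ring.
    have ab : 0 <= (1 - al) * (1 - be) by rewrite mulr_ge0 ?subr_ge0.
    by rewrite ler_wpM2l ?mulr_ge0 ?(ltW e20) ?(ltW nk0) //; lra.
  by apply: ler_pM => //; rewrite !mulr_ge0 ?ltW.
have -> : density_term k.+1 c * (al + be - 1) =
  (e2 * n%:R ^+ k.+1 * (al + be - 1)) * ((ntrees k.+1)%:R * c ^+ k / (F * n%:R ^+ k.+1)).
  by rewrite /density_term -/F -/e2 /=; field; rewrite !gt_eqF // -/F.
have -> : b * ((ntrees k.+1)%:R * ((c / n%:R) ^+ k * e1)) / n%:R =
  b * F * e1 * ((ntrees k.+1)%:R * c ^+ k / (F * n%:R ^+ k.+1)).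
  by rewrite exprMn exprVn exprS; field; rewrite !gt_eqF // exprn_gt0.
by rewrite ler_wpM2r // divr_ge0 ?mulr_ge0 ?exprn_ge0 ?(ltW F0).
Qed.

Lemma sum_mean_ncomps n K c : (0 < n)%N -> 0 <= c <= n%:R ->
  \sum_(k < K) k%:R * mean_ncomps n k c <= 1.
Proof.
move=> n0 cn; have n0R : 0 < n%:R :> R by rewrite ltr0n.
have P01 := edge_prob_itv n0 cn.
rewrite (eq_bigr (fun k : 'I_K => Ex (c / n%:R) (fun E : {set edge n} => k%:R * (ncomps k E)%:R) / n%:R)).
  rewrite -mulr_suml -Ex_sum ler_pdivrMr // mul1r -[X in _ <= X](@Ex_const _ (edge n) (c / n%:R)).
  apply: Ex_le => // E; rewrite (eq_bigr (fun k : 'I_K => (k * ncomps k E)%N%:R)).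
    by rewrite -natr_sum ler_nat sum_size_ncomps.
  by move=> k _; rewrite natrM.
by move=> k _; rewrite ExZ mulrA.
Qed.

Lemma mean_kappa_bounds n K c : (0 < n)%N -> (0 < K)%N -> 0 <= c <= n%:R ->
  \sum_(k < K) mean_ncomps n k c <= mean_kappa n c <=
  \sum_(k < K) mean_ncomps n k c + K%:R^-1.
Proof.
move=> n0 K0 cn; have n0R : 0 < n%:R :> R by rewrite ltr0n.
have K0R : 0 < K%:R :> R by rewrite ltr0n.
have P01 := edge_prob_itv n0 cn; rewrite /mean_kappa /mean_ncomps -mulr_suml -Ex_sum.
apply/andP; split.
  rewrite ler_pM2r ?invr_gt0 //; apply: Ex_le => // E.
  by rewrite -natr_sum ler_nat sum_ncomps_le_kappa.
have -> : K%:R^-1 = Ex (c / n%:R) (fun E : {set edge n} => n%:R / K%:R) / n%:R.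
  by rewrite Ex_const; field; rewrite !gt_eqF.
rewrite -mulrDl -ExD ler_pM2r ?invr_gt0 //; apply: Ex_le => // E.
rewrite -(ler_pM2l K0R) mulrDr.
have -> : K%:R * (n%:R / K%:R) = n%:R :> R by field; rewrite gt_eqF.
by rewrite -natr_sum -!natrM -natrD ler_nat kappa_le_sum_ncomps.
Qed.

(** A limit of [sum_mean_ncomps] for fixed [K] and [c]: the [n] below is chosen large enough that
    the correction [D / n] of [mean_ncomps_ge] is at most [eps]. *)
Lemma sum_size_fk K c : 0 <= c -> \sum_(k < K) k%:R * density_term k c <= 1.
Proof.
move=> c0; apply/ler_addgt0Pr => eps eps0.
pose D := \sum_(k < K) k%:R * density_term k c * (k%:R ^+ 2 + k%:R * c ^+ 2).
have D0 : 0 <= D.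
  by apply: sumr_ge0 => k _; rewrite !mulr_ge0 ?fk_ge0 ?addr_ge0 ?mulr_ge0 ?exprn_ge0.
pose n := (Num.trunc (D / eps + c)).+1.
have x0 : 0 <= D / eps + c by rewrite addr_ge0 // divr_ge0 // ltW.
have nD : D / eps + c < n%:R by rewrite -truncn_lt_nat.
have De0 : 0 <= D / eps by rewrite divr_ge0 // ltW.
have cn : 0 <= c <= n%:R by rewrite c0 /=; lra.
have n0R : 0 < n%:R :> R by rewrite ltr0n.
have := @sum_mean_ncomps n K c isT cn => H.
apply: (@le_trans _ _ (\sum_(k < K) k%:R * mean_ncomps n k c + D / n%:R)).
  rewrite /D mulr_suml -big_split /=; apply: ler_sum => k _.
  have := @mean_ncomps_ge n k c isT cn => Hk.
  have := ler_wpM2l (ler0n R k) Hk; lra.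
apply: lerD => //; rewrite ler_pdivrMr // mulrC -ler_pdivrMr //; lra.
Qed.

Definition density c : R := sup [set \sum_(k < K) density_term k c | K in [set: nat]].

(** Markov's inequality for sizes: beyond [K] each term is at most [k / K] times itself, and
    [sum_size_fk] bounds the total. *)
Lemma fk_partial K m c : (0 < K)%N -> 0 <= c ->
  \sum_(k < m) density_term k c <= \sum_(k < K) density_term k c + K%:R^-1.
Proof.
move=> K0 c0; have K0R : 0 < K%:R :> R by rewrite ltr0n.
rewrite -!(big_mkord predT (fun k => density_term k c)).
have [mK|/ltnW Km] := leqP m K.
  rewrite (@big_cat_nat _ _ _ m _ K) //= -addrA lerDl addr_ge0 ?invr_ge0 ?(ltW K0R) //.
  by apply: sumr_ge0 => k _; exact: fk_ge0.
rewrite (@big_cat_nat _ _ _ K _ m) //= lerD2l.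
have := sum_size_fk m c0; rewrite -(big_mkord predT (fun k => k%:R * density_term k c)).
rewrite (@big_cat_nat _ _ _ K _ m) //= => H.
rewrite -(ler_pM2l K0R) mulfV ?gt_eqF // mulr_sumr.
apply: (@le_trans _ _ (\sum_(K <= i < m) i%:R * density_term i c)).
  rewrite big_nat [X in _ <= X]big_nat; apply: ler_sum => k /andP[Kk _].
  by rewrite ler_wpM2r ?fk_ge0 // ler_nat.
apply: le_trans H; rewrite lerDr; apply: sumr_ge0 => k _; rewrite mulr_ge0 ?fk_ge0 //.
Qed.

Lemma fk_has_ub c : 0 <= c -> has_ubound [set \sum_(k < K) density_term k c | K in [set: nat]].
Proof.
move=> c0; exists (\sum_(k < 1) density_term k c + 1%:R^-1) => _ [m _ <-].
exact: fk_partial.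
Qed.

Lemma partial_le_f K c : 0 <= c -> \sum_(k < K) density_term k c <= density c.
Proof. by move=> c0; apply: ub_le_sup; [exact: fk_has_ub|exists K]. Qed.

Lemma f_le_partial K c : (0 < K)%N -> 0 <= c -> density c <= \sum_(k < K) density_term k c + K%:R^-1.
Proof.
move=> K0 c0; apply: ge_sup; first by exists (\sum_(k < 0) density_term k c), 0%N.
by move=> _ [m _ <-]; exact: fk_partial.
Qed.

Lemma f_ge0 c : 0 <= c -> 0 <= density c.
Proof. by move=> c0; have := partial_le_f 0 c0; rewrite big_ord0. Qed.

Lemma f_le1 c : 0 <= c -> density c <= 1.
Proof.
move=> c0; have := f_le_partial (ltn0Sn 0) c0.
by rewrite big_ord_recl big_ord0 /density_term ntrees0 !mul0r !add0r invr1.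
Qed.

Lemma f1_gt0 : 0 < density 1.
Proof.
apply: lt_le_trans (partial_le_f 2 ler01).
rewrite !big_ord_recl big_ord0 addr0 ltr_wpDl ?fk_ge0 //.
rewrite /density_term /= mulr_gt0 ?invr_gt0 // mulr_gt0 ?expR_gt0 // expr0 mulr1 ltr0n.
exact: ntrees1.
Qed.

Lemma mean_kappa_f n c : (0 < n)%N -> 0 <= c <= n%:R ->
  `|mean_kappa n c - density c| <= 2 * (1 + c) / Num.sqrt n%:R.
Proof.
move=> n0 cn; have n0R : 0 < n%:R :> R by rewrite ltr0n.
have /andP[c0 cn'] := cn.
set s := Num.sqrt n%:R; have s0 : 0 < s by rewrite sqrtr_gt0.
have sn : s ^+ 2 = n%:R by rewrite sqr_sqrtr // ltW.
have d0 : 0 < 1 + c by lra.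
(* This level balances the tail [1 / K] against the comparison errors [c r / n] and
   [r (1 + c^2) / n]: all three are at most [(1 + c) / s]. *)
set r := s / (1 + c); have r0 : 0 < r by rewrite divr_gt0.
pose K := (Num.trunc r).+1.
have rK : r < K%:R by rewrite -truncn_lt_nat // ltW.
have kr (k : 'I_K) : k%:R <= r.
  apply: le_trans (_ : (Num.trunc r)%:R <= r); first by rewrite ler_nat -ltnS.
  by have := truncn_itv (ltW r0) => /andP[].
have K1 : K%:R^-1 <= (1 + c) / s.
  have -> : (1 + c) / s = r^-1 by rewrite /r; field; rewrite !gt_eqF.
  by rewrite lef_pV2 ?posrE ?ltr0n // ltW.
have /andP[B1 B2] := mean_kappa_bounds n0 (ltn0Sn (Num.trunc r)) cn.
have F1 := partial_le_f K c0; have F2 := f_le_partial (ltn0Sn (Num.trunc r)) c0.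
rewrite -/K in B1 B2 F2.
have X1 : r * (1 + c) / n%:R <= s^-1.
  by rewrite /r -sn le_eqVlt; apply/orP; left; apply/eqP; field; rewrite !gt_eqF.
have U : \sum_(k < K) mean_ncomps n k c <= \sum_(k < K) density_term k c + (1 + c) / s.
  apply: (@le_trans _ _ (\sum_(k < K) density_term k c + c * r / n%:R * \sum_(k < K) k%:R * mean_ncomps n k c)).
    rewrite mulr_sumr -big_split /=; apply: ler_sum => k _.
    have H := @mean_ncomps_le n k c n0 cn.
    have N0 := mean_ncomps_ge0 k n0 cn.
    have : c * k%:R ^+ 2 / n%:R * mean_ncomps n k c <= c * r / n%:R * (k%:R * mean_ncomps n k c).
      have -> : c * r / n%:R * (k%:R * mean_ncomps n k c) = c * (k%:R * r) / n%:R * mean_ncomps n k c by ring.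
      rewrite ler_wpM2r // ler_wpM2r ?invr_ge0 // ler_wpM2l // expr2 ler_wpM2l //; exact: kr.
    lra.
  rewrite lerD2l; apply: (@le_trans _ _ (c * r / n%:R)).
    by rewrite ler_piMr ?sum_mean_ncomps // divr_ge0 // mulr_ge0 // ltW.
  apply: (@le_trans _ _ s^-1); last by rewrite ler_peMl ?invr_ge0 ?(ltW s0) // lerDl.
  apply: le_trans X1; rewrite ler_wpM2r ?invr_ge0 //; nra.
have V : \sum_(k < K) density_term k c <= \sum_(k < K) mean_ncomps n k c + (1 + c) / s.
  apply: (@le_trans _ _ (\sum_(k < K) mean_ncomps n k c + r * (1 + c ^+ 2) / n%:R * \sum_(k < K) k%:R * density_term k c)).
    rewrite mulr_sumr -big_split /=; apply: ler_sum => k _.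
    have H := @mean_ncomps_ge n k c n0 cn.
    have N0 := fk_ge0 k c0.
    have : density_term k c * ((k%:R ^+ 2 + k%:R * c ^+ 2) / n%:R) <= r * (1 + c ^+ 2) / n%:R * (k%:R * density_term k c).
      have -> : r * (1 + c ^+ 2) / n%:R * (k%:R * density_term k c) = density_term k c * ((k%:R * r + k%:R * (r * c ^+ 2)) / n%:R) by ring.
      rewrite ler_wpM2l // ler_wpM2r ?invr_ge0 // lerD //.
        by rewrite expr2 ler_wpM2l //; exact: kr.
      (* Inserting the factor [r] requires [1 <= r], which follows from [k <= r] as soon as [k] is
         positive. *)
      case: k {H N0} => [[|k] kK]; first by rewrite !mul0r.
      rewrite ler_wpM2l // ler_peMl ?exprn_ge0 //.
      by apply: le_trans (kr (Ordinal kK)); rewrite ler1n.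
    lra.
  rewrite lerD2l; apply: (@le_trans _ _ (r * (1 + c ^+ 2) / n%:R)).
    rewrite ler_piMr ?sum_size_fk // divr_ge0 // mulr_ge0 ?(ltW r0) //.
    by rewrite addr_ge0 ?exprn_ge0.
  apply: (@le_trans _ _ (r * (1 + c) / n%:R * (1 + c))).
    have -> : r * (1 + c) / n%:R * (1 + c) = r * ((1 + c) ^+ 2) / n%:R by ring.
    rewrite ler_wpM2r ?invr_ge0 // ler_wpM2l ?(ltW r0) //.
    by rewrite sqrrD expr1n mul1r; lra.
  by rewrite mulrC ler_wpM2l // ltW.
rewrite ler_norml; have -> : 2 * (1 + c) / s = (1 + c) / s + (1 + c) / s by ring.
apply/andP; split; lra.
Qed.

Lemma mean_kappa_antitone n c c' : (0 < n)%N -> 0 <= c -> c <= c' -> c' <= n%:R ->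
  mean_kappa n c' <= mean_kappa n c.
Proof.
move=> n0 c0 cc' cn; have n0R : 0 < n%:R :> R by rewrite ltr0n.
rewrite ler_pM2r ?invr_gt0 //; apply: Ex_antitone; last exact: kappa_unit_decr.
- by rewrite divr_ge0.
- by rewrite ler_pM2r ?invr_gt0.
- by rewrite ler_pdivrMr // mul1r.
Qed.

(** The single terms with [k >= 2] are not monotone in [c]; monotonicity passes to the limit from
    [mean_kappa] through [mean_kappa_f]. *)
Lemma f_antitone c c' : 0 <= c -> c <= c' -> density c' <= density c.
Proof.
move=> c0 cc'; apply/ler_addgt0Pr => eps eps0.
pose A := 4 * (1 + c') / eps.
have A0 : 0 <= A by rewrite divr_ge0 ?mulr_ge0 //; lra.
pose n := (Num.trunc (A ^+ 2 + c')).+1.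
have x0 : 0 <= A ^+ 2 + c' by rewrite addr_ge0 ?exprn_ge0 //; lra.
have nA : A ^+ 2 + c' < n%:R by rewrite -truncn_lt_nat.
have A20 : 0 <= A ^+ 2 by rewrite exprn_ge0.
have n0R : 0 < n%:R :> R by rewrite ltr0n.
have sA : A <= Num.sqrt n%:R.
  by rewrite -(ger0_norm A0) -sqrtr_sqr ler_wsqrtr //; lra.
have s0 : 0 < Num.sqrt n%:R :> R by rewrite sqrtr_gt0.
have := @mean_kappa_f n c isT _; rewrite c0 /=; have -> : c <= n%:R by lra.
move=> /(_ isT); rewrite ler_norml => /andP[_ H1].
have := @mean_kappa_f n c' isT _; have -> : 0 <= c' <= n%:R by apply/andP; split; lra.
move=> /(_ isT); rewrite ler_norml => /andP[H2 _].
have H3 : mean_kappa n c' <= mean_kappa n c by apply: mean_kappa_antitone => //; lra.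
have E : 4 * (1 + c') / Num.sqrt n%:R <= eps.
  by rewrite ler_pdivrMr // [eps * _]mulrC -ler_pdivrMr.
have : 2 * (1 + c) / Num.sqrt n%:R <= 2 * (1 + c') / Num.sqrt n%:R.
  by rewrite ler_pM2r ?invr_gt0 //; lra.
lra.
Qed.

(** The bound [density_term k 1 <= 1] gives [T_k / k! <= e^k], so the terms at [c] are at most
    [(c e^(1 - c))^k]. For [c >= 4] this is a geometric series of ratio at most [z <= 1/2]. *)
Lemma f_tail c : 4 <= c -> density c <= 4 * expR (- (c / 2)).
Proof.
move=> c4; have c0 : 0 <= c by lra.
set z := 2 * expR (- (c / 2)).
have z0 : 0 <= z by rewrite mulr_ge0 ?expR_ge0.
have e2 : expR (-(c/2)) <= 4^-1.
  apply: (@le_trans _ _ (expR (-2))); first by rewrite ler_expR; lra.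
  rewrite expRN lef_pV2 ?posrE ?expR_gt0 //.
  have -> : 2 = 2%:R * 1 :> R by ring.
  rewrite expRM_natl; have := expR_ge1Dx (1 : R); nra.
have z12 : z <= 2^-1 by rewrite /z; lra.
have cz : c * expR (1 - c) <= z.
  have H := expR_ge1Dx (c / 2 - 1).
  have -> : 1 - c = - (c / 2) + - (c / 2 - 1) by lra.
  have -> : z = (2 * expR (c / 2 - 1)) * (expR (- (c / 2)) * expR (- (c / 2 - 1))).
    by rewrite /z [expR (- (c / 2 - 1))]expRN; field; rewrite gt_eqF ?expR_gt0.
  by rewrite expRD ler_wpM2r ?mulr_ge0 ?expR_ge0 //; lra.
have tk k : (ntrees k.+1)%:R / k.+1`!%:R <= expR (k.+1%:R) :> R.
  have := sum_size_fk k.+2 (ler01 : 0 <= 1 :> R).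
  rewrite big_ord_recr /= => H.
  have H1 : k.+1%:R * density_term k.+1 1 <= 1.
    apply: le_trans H; rewrite lerDr; apply: sumr_ge0 => i _.
    by rewrite mulr_ge0 ?fk_ge0.
  have : density_term k.+1 1 <= 1 by apply: le_trans H1; rewrite ler_peMl ?fk_ge0 // ler1n.
  rewrite /density_term expr1n !mulr1 expRN mulrAC ler_pdivrMr ?expR_gt0 // mul1r //.
have fz k : density_term k.+1 c <= z * 2^-1 ^+ k.
  apply: (@le_trans _ _ (z ^+ k.+1)); last first.
    by rewrite exprS ler_wpM2l // lerXn2r ?nnegrE ?invr_ge0.
  apply: (@le_trans _ _ ((c * expR (1 - c)) ^+ k.+1)); last first.
    by rewrite lerXn2r ?nnegrE ?mulr_ge0 ?expR_ge0.
  rewrite exprMn -expRM_natl mulrBr mulr1 expRD /density_term /=.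
  have -> : (ntrees k.+1)%:R * c ^+ k * expR (- (k.+1%:R * c)) / k.+1`!%:R =
    (c ^+ k * expR (- (k.+1%:R * c))) * ((ntrees k.+1)%:R / k.+1`!%:R) by ring.
  apply: le_trans (ler_wpM2l _ (tk k)) _; first by rewrite mulr_ge0 ?exprn_ge0 ?expR_ge0.
  rewrite [X in _ <= _ * X]mulrC mulrA ler_wpM2r ?expR_ge0 // ler_wpM2r ?expR_ge0 //.
  by rewrite exprS ler_peMl ?exprn_ge0 //; lra.
have part K : \sum_(k < K.+1) density_term k c <= z * (2 - 2 * 2^-1 ^+ K).
  elim: K => [|K IH]; first by rewrite big_ord_recl big_ord0 /density_term ntrees0 !mul0r addr0 expr0; lra.
  rewrite big_ord_recr /=; apply: le_trans (lerD IH (fz K)) _.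
  by rewrite -mulrDr ler_wpM2l // exprS; lra.
have -> : 4 * expR (- (c / 2)) = z * 2 by rewrite /z; ring.
apply: ge_sup; first by exists (\sum_(k < 0) density_term k c), 0%N.
move=> _ [[|K] _ <-]; first by rewrite big_ord0 mulr_ge0.
apply: le_trans (part K) _; rewrite ler_wpM2l // gerBl mulr_ge0 // exprn_ge0 // invr_ge0 //.
Qed.
End limit_density.

(** * The limit constant *)

Section dyadic_sums.
Variables (R : realType) (phi : R -> R).
Hypothesis phi_antitone : forall s t, 0 <= s -> s <= t -> phi t <= phi s.
Hypothesis phi_ge0 : forall s, 0 <= s -> 0 <= phi s.
Hypothesis phi_le1 : forall s, 0 <= s -> phi s <= 1.

Definition dyadic (i j : nat) : R := j%:R / 2 ^+ i.

(** Right endpoints give a lower sum on [[0, J]] because [phi] is antitone; [upper] uses left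
    endpoints, on [[m, J]]. *)
Definition lower i J : R := (\sum_(0 <= j < J * 2 ^ i) phi (dyadic i j.+1)) / 2 ^+ i.
Definition upper i m J : R := (\sum_(m * 2 ^ i <= j < J * 2 ^ i) phi (dyadic i j)) / 2 ^+ i.

Lemma dyadic_ge0 i j : 0 <= dyadic i j.
Proof. by rewrite divr_ge0 // exprn_ge0. Qed.

Lemma dyadic_le i j k : (j <= k)%N -> dyadic i j <= dyadic i k.
Proof. by move=> jk; rewrite ler_wpM2r ?invr_ge0 ?exprn_ge0 // ler_nat. Qed.

Lemma dyadic_double i j : dyadic i.+1 j.*2 = dyadic i j.
Proof.
rewrite /dyadic -muln2 natrM exprS invfM; have : 2 ^+ i != 0 :> R by rewrite expf_neq0.
by move=> H; field.
Qed.

Lemma dyadic_nat i j : dyadic i (j * 2 ^ i) = j%:R.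
Proof. by rewrite /dyadic natrM natrX mulfK // expf_neq0. Qed.

Lemma sum_double (F : nat -> R) m N : (m <= N)%N ->
  \sum_(m.*2 <= j < N.*2) F j = \sum_(m <= j < N) (F j.*2 + F j.*2.+1).
Proof.
move=> mN; rewrite -(subnKC mN); elim: (N - m)%N => [|d IH].
  by rewrite addn0 !big_geq.
rewrite addnS doubleS big_nat_recr /=; last by rewrite -!addnn; lia.
rewrite big_nat_recr /=; last by rewrite -!addnn; lia.
by rewrite IH big_nat_recr ?leq_addr //= addrA.
Qed.

Lemma div2S (x : R) i : x / 2 ^+ i.+1 = 2^-1 * x / 2 ^+ i.
Proof. by rewrite exprS invfM; ring. Qed.

Lemma mul_expS J i : (J * 2 ^ i.+1 = (J * 2 ^ i).*2)%N.
Proof. by rewrite expnS -muln2; lia. Qed.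

Lemma lower_refine i J : lower i J <= lower i.+1 J.
Proof.
have := @sum_double (fun j => phi (dyadic i.+1 j.+1)) 0 (J * 2 ^ i) (leq0n _).
rewrite double0 => H; rewrite /lower div2S mul_expS H ler_wpM2r ?invr_ge0 ?exprn_ge0 //.
rewrite mulr_sumr; apply: ler_sum => j _.
have H1 : phi (dyadic i j.+1) <= phi (dyadic i.+1 j.*2.+1).
  apply: phi_antitone; first exact: dyadic_ge0.
  by rewrite -(dyadic_double i) dyadic_le // doubleS.
have H2 : phi (dyadic i j.+1) = phi (dyadic i.+1 j.*2.+2) by rewrite -doubleS dyadic_double.
by rewrite -H2; lra.
Qed.

Lemma upper_refine i m J : (m <= J)%N -> upper i.+1 m J <= upper i m J.
Proof.
move=> mJ; rewrite /upper div2S !mul_expS sum_double ?leq_mul2r ?mJ ?orbT //.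
rewrite ler_wpM2r ?invr_ge0 ?exprn_ge0 // mulr_sumr; apply: ler_sum => j _.
have H1 : phi (dyadic i.+1 j.*2.+1) <= phi (dyadic i j).
  apply: phi_antitone; first exact: dyadic_ge0.
  by rewrite -(dyadic_double i) dyadic_le.
by rewrite dyadic_double; lra.
Qed.

Lemma lower_mono_i i i' J : (i <= i')%N -> lower i J <= lower i' J.
Proof.
move=> ii'; rewrite -(subnKC ii'); elim: (i' - i)%N => [|d IH]; first by rewrite addn0.
by rewrite addnS; apply: le_trans IH (lower_refine _ _).
Qed.

Lemma upper_mono_i i i' m J : (m <= J)%N -> (i <= i')%N -> upper i' m J <= upper i m J.
Proof.
move=> mJ ii'; rewrite -(subnKC ii'); elim: (i' - i)%N => [|d IH]; first by rewrite addn0.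
by rewrite addnS; apply: le_trans (upper_refine _ mJ) IH.
Qed.

Lemma lower_mono_J i J J' : (J <= J')%N -> lower i J <= lower i J'.
Proof.
move=> JJ'; rewrite ler_wpM2r ?invr_ge0 ?exprn_ge0 //.
rewrite (@big_cat_nat _ _ _ (J * 2 ^ i) 0 (J' * 2 ^ i)) ?leq_mul2r ?JJ' ?orbT //=.
by rewrite lerDl; apply: sumr_ge0 => j _; apply: phi_ge0; exact: dyadic_ge0.
Qed.

Lemma lower_le_upper i J : lower i J <= upper i 0 J.
Proof.
rewrite /upper mul0n ler_wpM2r ?invr_ge0 ?exprn_ge0 //; apply: ler_sum => j _.
by apply: phi_antitone; [exact: dyadic_ge0|exact: dyadic_le].
Qed.

(** The difference telescopes to the mesh times [phi 0 - phi J]. *)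
Lemma upper_le_lower i J : upper i 0 J <= lower i J + (2 ^+ i)^-1.
Proof.
rewrite /upper /lower mul0n -[X in _ <= _ + X]mul1r -mulrDl ler_wpM2r ?invr_ge0 ?exprn_ge0 //.
rewrite -lerBlDl -sumrB.
rewrite (eq_bigr (fun j => (- phi (dyadic i j.+1)) - (- phi (dyadic i j)))); last first.
  by move=> j _; rewrite opprK addrC.
rewrite telescope_sumr //.
have := phi_le1 (dyadic_ge0 i 0); have := phi_ge0 (dyadic_ge0 i (J * 2 ^ i)); lra.
Qed.

Lemma upper_cat i J J' : (J <= J')%N -> upper i 0 J' = upper i 0 J + upper i J J'.
Proof.
move=> JJ'; rewrite /upper -mulrDl mul0n.
by rewrite (@big_cat_nat _ _ _ (J * 2 ^ i) 0 (J' * 2 ^ i)) ?leq_mul2r ?JJ' ?orbT.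
Qed.

(** The improper integral of [phi] over [[0, oo)]: dyadic grids are nested, so the lower sums
    increase in both indices. *)
Definition dyadic_integral : R := sup [set lower ij.1 ij.2 | ij in [set: nat * nat]].

(** Both sums are compared on a common grid. Up to [J] the upper sum exceeds the lower one by at
    most the mesh; beyond [J] it is at most the upper sum of mesh 1, which [tau] bounds. *)
Lemma lower_le (tau : R) i J : 
  (forall J', (J <= J')%N -> \sum_(J <= l < J') phi l%:R <= tau) ->
  forall i' J', lower i' J' <= lower i J + (2 ^+ i)^-1 + tau.
Proof.
move=> Htau i' J'.
pose i'' := maxn i i'; pose J'' := maxn J J'.
apply: (le_trans (lower_mono_i J' (leq_maxr i i'))).
apply: (le_trans (lower_mono_J _ (leq_maxr J J'))).
apply: (le_trans (lower_le_upper _ _)).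
apply: (le_trans (upper_mono_i (leq0n _) (leq_maxl i i'))).
rewrite (upper_cat _ (leq_maxl J J')); apply: lerD; first exact: upper_le_lower.
apply: (le_trans (upper_mono_i (leq_maxl J J') (leq0n i))).
rewrite /upper expn0 !muln1 expr0 divr1; apply: le_trans (Htau _ (leq_maxl J J')).
by apply: ler_sum => j _; rewrite /dyadic expr0 divr1.
Qed.

Lemma dyadic_integral_bounds (tau : R) i J :
  (forall J', (J <= J')%N -> \sum_(J <= l < J') phi l%:R <= tau) ->
  lower i J <= dyadic_integral <= lower i J + (2 ^+ i)^-1 + tau.
Proof.
move=> Htau; apply/andP; split.
  apply: ub_le_sup; last by exists (i, J).
  by exists (lower i J + (2 ^+ i)^-1 + tau) => _ [ij _ <-]; exact: lower_le.
apply: ge_sup; first by exists (lower 0 0), (0, 0)%N.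
by move=> _ [ij _ <-]; exact: lower_le.
Qed.
End dyadic_sums.

(** * Decay of the integrand and existence of the constant *)

Section constant.
Variables (R : realType) (q : R).
Hypothesis q0 : 0 < q.

Definition phi (s : R) : R := density (s `^ q).

Lemma phi_antitone s t : 0 <= s -> s <= t -> phi t <= phi s.
Proof.
move=> s0 st; apply: f_antitone; first exact: powR_ge0.
by apply: ge0_ler_powR; rewrite ?nnegrE ?(ltW q0) //; apply: le_trans st.
Qed.

Lemma phi_ge0 s : 0 <= s -> 0 <= phi s.
Proof. by move=> _; apply: f_ge0; exact: powR_ge0. Qed.

Lemma phi_le1 s : 0 <= s -> phi s <= 1.
Proof. by move=> _; apply: f_le1; exact: powR_ge0. Qed.

Lemma expR_ge_pow (x : R) m : 0 <= x -> (x / m.+1%:R) ^+ m.+1 <= expR x.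
Proof.
move=> x0; have -> : x = m.+1%:R * (x / m.+1%:R) by rewrite mulrC divfK ?pnatr_eq0.
rewrite expRM_natl mulrC mulKf ?pnatr_eq0 // lerXn2r ?nnegrE ?expR_ge0 ?divr_ge0 //.
by apply: le_trans (expR_ge1Dx _); rewrite lerDr.
Qed.

Lemma f_pow_bound m : exists2 C : R, 0 <= C & forall c, 0 <= c -> density c * c ^+ m.+1 <= C.
Proof.
set M : R := 2 * m.+1%:R; have M0 : 0 < M by rewrite mulr_gt0.
exists (4 ^+ m.+1 + 4 * M ^+ m.+1); first by rewrite addr_ge0 ?mulr_ge0 ?exprn_ge0 // ltW.
move=> c c0; have [c4|c4] := leP c 4.
  apply: (@le_trans _ _ (4 ^+ m.+1)); last by rewrite lerDl mulr_ge0 ?exprn_ge0 // ltW.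
  rewrite -[X in _ <= X]mul1r; apply: ler_pM; rewrite ?f_ge0 ?exprn_ge0 ?f_le1 //.
  by rewrite lerXn2r ?nnegrE.
apply: (@le_trans _ _ (4 * M ^+ m.+1)); last by rewrite lerDr exprn_ge0.
apply: le_trans (ler_wpM2r (exprn_ge0 _ c0) (f_tail (ltW c4))) _.
rewrite -mulrA ler_wpM2l // expRN mulrC ler_pdivrMr ?expR_gt0 //.
have c20 : 0 <= c / 2 by rewrite divr_ge0.
have := expR_ge_pow m c20; have -> : c / 2 / m.+1%:R = c / M by rewrite /M invfM mulrA.
by rewrite expr_div_n ler_pdivrMr ?exprn_gt0 // [X in _ <= X -> _]mulrC.
Qed.

(** The integrand decays like [l^-(N + 2)]: the power [N] is bounded by its value at [J], and the
    remaining [l^-2] is at most twice the telescoping difference [1 / l - 1 / (l + 1)]. *)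
Lemma phi_tail N : exists2 C : R, 0 <= C & forall J J', (0 < J)%N -> (J <= J')%N ->
  \sum_(J <= l < J') phi l%:R <= C / J%:R ^+ N.
Proof.
(* Chosen so that [q (m + 1) >= N + 2], which turns a power of [l^q] into a power of [l]. *)
pose m := Num.trunc (N.+2%:R / q).
have mq : N.+2%:R / q <= m.+1%:R by rewrite ltW // -truncn_lt_nat // divr_ge0 // ltW.
have [C C0 HC] := f_pow_bound m; exists (2 * C); first by rewrite mulr_ge0.
move=> J J' J0 JJ'.
have J0R : 0 < J%:R :> R by rewrite ltr0n.
have H l : (J <= l)%N -> phi l%:R <= 2 * C / J%:R ^+ N * (l%:R^-1 - l.+1%:R^-1).
  move=> Jl; have l0 : (0 < l)%N by apply: leq_trans Jl.
  have l0R : 0 < l%:R :> R by rewrite ltr0n.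
  have l1R : 1 <= l%:R :> R by rewrite ler1n.
  have := HC _ (powR_ge0 l%:R q); rewrite -/(phi _) => H1.
  have H2 : l%:R ^+ N.+2 <= (l%:R `^ q) ^+ m.+1.
    rewrite -[X in _ <= X]powR_mulrn ?powR_ge0 // -powRrM -powR_mulrn ?(ltW l0R) //.
    by rewrite ler_powR // mulrC -ler_pdivrMr.
  have H3 : phi l%:R * l%:R ^+ N.+2 <= C.
    by apply: le_trans H1; rewrite ler_wpM2l // phi_ge0.
  rewrite -ler_pdivlMr ?exprn_gt0 // in H3; apply: le_trans H3 _.
  have -> : l%:R^-1 - l.+1%:R^-1 = (l%:R * l.+1%:R)^-1 :> R.
    by rewrite -natr1; field; rewrite natr1 !gt_eqF // ltr0n.
  have JlN : (l%:R ^+ N)^-1 <= (J%:R ^+ N)^-1 :> R.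
    by rewrite lef_pV2 ?posrE ?exprn_gt0 // lerXn2r ?nnegrE ?ler0n // ler_nat.
  have ll : (l%:R * l%:R)^-1 <= 2 * (l%:R * l.+1%:R)^-1 :> R.
    have l1 : 0 < l.+1%:R :> R by rewrite ltr0n.
    rewrite ler_pdivlMr ?mulr_gt0 // mulrC ler_pdivrMr ?mulr_gt0 //.
    by rewrite mulrCA ler_pM2l // -natr1; lra.
  have -> : C / l%:R ^+ N.+2 = C * ((l%:R ^+ N)^-1 * (l%:R * l%:R)^-1).
    by rewrite !exprSr !invfM !mulrA.
  have -> : 2 * C / J%:R ^+ N * (l%:R * l.+1%:R)^-1 =
    C * ((J%:R ^+ N)^-1 * (2 * (l%:R * l.+1%:R)^-1)) by ring.
  by rewrite ler_wpM2l // ler_pM // invr_ge0 ?mulr_ge0 ?exprn_ge0 ?ler0n.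
apply: (@le_trans _ _ (\sum_(J <= l < J') 2 * C / J%:R ^+ N * (l%:R^-1 - l.+1%:R^-1))).
  by rewrite big_nat [X in _ <= X]big_nat; apply: ler_sum => l /andP[Jl _]; exact: H.
rewrite -mulr_sumr ler_piMr ?divr_ge0 ?mulr_ge0 ?exprn_ge0 //.
rewrite (eq_bigr (fun l => (- l.+1%:R^-1) - (- l%:R^-1) : R)); last by move=> l _; rewrite opprK addrC.
rewrite telescope_sumr // opprK.
have : J%:R^-1 <= 1 :> R by rewrite invf_le1 // ler1n.
have : 0 <= J'%:R^-1 :> R by rewrite invr_ge0.
lra.
Qed.

(** The constant precedes [N], so the order of the tail bound can be adapted later to the small
    exponent of [J]. *)
Lemma constant_exists : exists2 c : R, 0 < c & forall N, exists2 C : R, 0 <= C &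
  forall i J, (0 < J)%N ->
  lower phi i J <= c <= lower phi i J + (2 ^+ i)^-1 + C / J%:R ^+ N.
Proof.
exists (dyadic_integral phi).
  have [C C0 HC] := phi_tail 0.
  have /andP[+ _] := @dyadic_integral_bounds R phi phi_antitone phi_ge0 phi_le1 (C / 1 ^+ 0) 0 1
    (fun J' => @HC 1%N J' isT).
  (* Positivity: the coarsest lower sum on [[0, 1]] is [phi 1], that is [density 1]. *)
  apply: lt_le_trans; rewrite /lower expn0 muln1 big_nat1 expr0 divr1 /dyadic expr0 divr1.
  by rewrite /phi powR1 f1_gt0.
move=> N; have [C C0 HC] := phi_tail N; exists C => // i J J0.
apply: dyadic_integral_bounds; [exact: phi_antitone|exact: phi_ge0|exact: phi_le1|].
by move=> J'; exact: HC.
Qed.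
End constant.

(** * Kruskal's formula on a grid of thresholds *)

Section grid.
Variables (R : realType) (n : nat) (x : edge n -> R).
Hypothesis n0 : (0 < n)%N.

Definition sublevel (t : R) : {set edge n} := [set e | x e <= t]%SET.

Lemma sublevel_sub s t : s <= t -> sublevel s \subset sublevel t.
Proof.
by move=> st; apply/fintype.subsetP => e; rewrite !inE => /le_trans; exact.
Qed.

(** A discrete layer-cake formula: a weight is compared with a multiple of [d] below it, and in
    [steps_ge] with one above it, both written as sums of indicators of thresholds. *)
Lemma steps_le (y d : R) N : 0 <= y -> 0 <= d ->
  \sum_(0 <= j < N) d * (j.+1%:R * d < y)%R%:R <= y.
Proof.
move=> y0 d0; elim: N => [|N IH]; first by rewrite big_geq.
rewrite big_nat_recr //=; case: ltP => Ny; last by rewrite mulr0 addr0.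
apply: le_trans (ltW Ny); rewrite -natr1 mulrDl mul1r mulr1 lerD2r.
apply: (@le_trans _ _ (\sum_(0 <= j < N) d)).
  by apply: ler_sum => j _; rewrite ler_piMr // lern1 leq_b1.
by rewrite big_const_nat subn0 iter_addr_0 mulr_natl.
Qed.

Lemma steps_ge (y d : R) N : 0 <= d -> y <= N%:R * d ->
  y <= \sum_(0 <= j < N) d * (j%:R * d < y)%R%:R.
Proof.
move=> d0; elim: N => [|N IH] yN; first by rewrite big_geq // -(mul0r d).
rewrite big_nat_recr //=; case: ltP => Ny; last by rewrite mulr0 addr0 IH.
apply: (le_trans yN); rewrite -natr1 mulrDl mul1r mulr1 lerD2r.
apply: (@le_trans _ _ (\sum_(0 <= j < N) d)).
  by rewrite big_const_nat subn0 iter_addr_0 mulr_natl.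
apply: ler_sum_nat => j /andP[_ jN].
by rewrite (le_lt_trans _ Ny) ?mulr1 // ler_wpM2r // ler_nat ltnW.
Qed.

Lemma sum_steps (T : {set edge n}) (d : R) N (g : nat -> R) :
  \sum_(e in T) \sum_(0 <= j < N) d * (g j < x e)%R%:R =
  \sum_(0 <= j < N) d * #|T :\: sublevel (g j)|%:R.
Proof.
rewrite exchange_big /=; apply: eq_bigr => j _; rewrite -mulr_sumr; congr (_ * _).
rewrite -sum1_card natr_sum big_mkcond [RHS]big_mkcond /=.
apply: eq_bigr => e _; rewrite !inE ltNge; case: (e \in T) => /=; last by rewrite andbF.
by case: (x e <= g j).
Qed.

(** Layer-cake on the minimal tree itself: whichever it is, at least [kappa - 1] of its edges lie
    above each threshold. *)
Lemma mst_weight_ge (d : R) N : (forall e, 0 <= x e) -> 0 <= d ->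
  \sum_(0 <= j < N) d * ((kappa (sublevel (j.+1%:R * d)))%:R - 1) <= mst_weight x.
Proof.
move=> x0 d0; have [[T [_ cT _] ->] _] := mst_weight_min x n0.
apply: (@le_trans _ _ (\sum_(e in T) \sum_(0 <= j < N) d * (j.+1%:R * d < x e)%R%:R)).
  rewrite (@sum_steps T d N (fun j => j.+1%:R * d)); apply: ler_sum => j _.
  by rewrite ler_wpM2l // lerBlDr natr1 ler_nat card_setD_kappa.
by apply: ler_sum => e _; exact: steps_le.
Qed.

(** Layer-cake on the tree of [kruskal_chain]. Connectedness at the last threshold ensures that no
    weight of this tree exceeds the grid. *)
Lemma mst_weight_le (d : R) N : 0 <= d -> (kappa (sublevel (N%:R * d)) <= 1)%N ->
  mst_weight x <= \sum_(0 <= j < N) d * ((kappa (sublevel (j%:R * d)))%:R - 1).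
Proof.
move=> d0 k1; have cN := (connected_kappa _ n0).2 k1.
have [|T [sT TN Tj]] := @kruskal_chain n (fun j => sublevel (j%:R * d)) N n0 _ cN.
  by move=> i j ij; apply: sublevel_sub; rewrite ler_wpM2r // ler_nat.
have [_ H] := mst_weight_min x n0; apply: (le_trans (H _ sT)).
apply: (@le_trans _ _ (\sum_(e in T) \sum_(0 <= j < N) d * (j%:R * d < x e)%R%:R)).
  apply: ler_sum => e eT; apply: steps_ge => //.
  by have := fintype.subsetP TN _ eT; rewrite inE.
rewrite (@sum_steps T d N (fun j => j%:R * d)).
apply: ler_sum_nat => j /andP[_ jN]; rewrite ler_wpM2l // lerBrDr natr1 ler_nat.
exact/Tj/ltnW.
Qed.
End grid.

(** * The threshold graphs of the random weights *)

Section root_law.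
Variables (R : realType) (q : R) (d : measure_display) (Omega : measurableType d).
Variables (P : probability Omega R) (X : {RV P >-> R}).
Hypotheses (q0 : 0 < q) (law : uniform_root_law q X).

Lemma root_law_itv (t : R) : 0 <= t <= 1 -> P (X @^-1` `]-oo, t]) = (t `^ q)%:E.
Proof.
move=> /andP[t0 t1]; have := law (measurable_itv `]-oo, t]); rewrite /distribution /pushforward => ->.
rewrite /uniform_prob integral_uniform_pdf.
have tq0 : 0 <= t `^ q by exact: powR_ge0.
have tq1 : t `^ q <= 1.
  rewrite (_ : 1 = 1 `^ q); last by rewrite powR1.
  by apply: ge0_ler_powR; rewrite ?nnegrE ?(ltW q0).
have qi0 : 0 <= q^-1 by rewrite invr_ge0 ltW.
have -> : ((fun u : R => u `^ q^-1) @^-1` `]-oo, t]%classic) `&` `[0, 1]%classic = `[0, t `^ q]%classic.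
  apply/seteqP; split=> u /=; rewrite !in_itv /=.
    move=> [ut /andP[u0 u1]]; rewrite u0 /=.
    have -> : u = (u `^ q^-1) `^ q by rewrite -powRrM mulVf ?gt_eqF // powRr1.
    by apply: ge0_ler_powR; rewrite ?nnegrE ?(ltW q0) ?powR_ge0.
  move=> /andP[u0 ut]; split; last by rewrite u0 (le_trans ut).
  have -> : t = (t `^ q) `^ q^-1 by rewrite -powRrM mulfV ?gt_eqF // powRr1.
  by apply: ge0_ler_powR; rewrite ?nnegrE.
rewrite (eq_integral (cst 1%E)).
  rewrite integral_cst //= lebesgue_measure_itv /= lte_fin mul1e.
  case: ltP => [_|h]; first by rewrite oppr0 adde0.
  by congr (_%:E); apply/le_anti; rewrite h tq0.
move=> u; rewrite inE /= in_itv /= => /andP[u0 ut]; rewrite /uniform_pdf u0 (le_trans ut tq1) /=.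
by rewrite subr0 invr1.
Qed.

Lemma root_law_neg : P [set w | X w < 0] = 0%E.
Proof.
have := law (measurable_itv `]-oo, 0[); rewrite /distribution /pushforward.
have -> : X @^-1` `]-oo, 0[ = [set w | X w < 0].
  by apply/seteqP; split=> w /=; rewrite in_itv.
move=> ->; have -> : (fun u : R => u `^ q^-1) @^-1` `]-oo, 0[ = set0.
  by apply/seteqP; split=> u //=; rewrite in_itv /= ltNge powR_ge0.
by rewrite measure0.
Qed.
End root_law.

Section random_graph.
Variables (R : realType) (q : R) (d : measure_display) (Omega : measurableType d).
Variables (P : probability Omega R) (n : nat) (X : edge n -> {RV P >-> R}).
Hypotheses (q0 : 0 < q) (indX : independent_RVs X).
Hypothesis lawX : forall e, uniform_root_law q (X e).

Definition gph (t : R) (w : Omega) : {set edge n} := sublevel (fun e => X e w) t.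

Let B t (E : {set edge n}) e : set R := 
  if e \in E then (`]-oo, t]%classic : set R) else ~` `]-oo, t]%classic.

Let mB t E e : measurable (B t E e).
Proof. by rewrite /B; case: ifP => _; [|apply: measurableC]; exact: measurable_itv. Qed.

Let fiberE t E : [set w | gph t w = E] =
  \bigcap_(e in [set` [set: edge n]%SET]) (X e @^-1` B t E e).
Proof.
apply/seteqP; split=> w /=.
  move=> <- e _; rewrite /B /=; case: ifPn; rewrite inE /=; first by rewrite in_itv.
  by rewrite in_itv /= => /negP.
move=> H; apply/setP => e; have := H e; rewrite /= !inE => /(_ isT).
rewrite /B; case: (e \in E) => /=; rewrite in_itv //=; last by move/negP/negbTE.
Qed.

Let measurable_preim e A : measurable A -> measurable (X e @^-1` A).
Proof. by move=> mA; rewrite -[X in measurable X]setTI; apply: measurable_funPT. Qed.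

Lemma measurable_fiber t E : measurable [set w | gph t w = E].
Proof.
rewrite fiberE; apply: fin_bigcap_measurable; first exact: finite_finset.
by move=> e _; apply: measurable_preim.
Qed.

(** The bridge to the finite Bernoulli model: the event splits into independent conditions, one on
    each weight. *)
Lemma prob_fiber t E : 0 <= t <= 1 -> P [set w | gph t w = E] = (wt (t `^ q) E)%:E.
Proof.
move=> t01; rewrite fiberE (indX _ (mB t E)).
rewrite /wt -prodEFin; apply: eq_big => [e|e _]; first by rewrite inE.
rewrite /B; case: ifP => _; first by rewrite (root_law_itv q0 (lawX e)).
rewrite preimage_setC probability_setC ?(root_law_itv q0 (lawX e)) //.
exact: (measurable_preim e (measurable_itv `]-oo, t])).
Qed.

Let hE (h : {set edge n} -> R) t w :
  (h (gph t w))%:E = (\sum_(E : {set edge n}) (h E * \1_[set w | gph t w = E] w)%:E)%E.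
Proof.
rewrite sumEFin; congr (_%:E); rewrite (bigD1 (gph t w)) //= indicE mem_set // mulr1.
rewrite big1 ?addr0 // => E EG; rewrite indicE memNset ?mulr0 //=.
by move=> GE; rewrite GE eqxx in EG.
Qed.

Let measurable_term (h : {set edge n} -> R) t E :
  measurable_fun setT (fun w => (h E * \1_[set w | gph t w = E] w)%:E).
Proof.
apply/measurable_EFinP; apply: measurable_funM => //.
by apply: measurable_indic; exact: measurable_fiber.
Qed.

Lemma measurable_gph (h : {set edge n} -> R) t : measurable_fun setT (fun w => h (gph t w)).
Proof.
apply/measurable_EFinP; rewrite (_ : EFin \o _ = (fun w =>
  (\sum_(E : {set edge n}) (h E * \1_[set w | gph t w = E] w)%:E)%E)); last first.
  by apply/funext => w; rewrite /= hE.
by apply: emeasurable_sum => E; exact: measurable_term.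
Qed.

Lemma integral_gph (h : {set edge n} -> R) t : 0 <= t <= 1 -> (forall E, 0 <= h E) ->
  (\int[P]_w (h (gph t w))%:E = (Ex (t `^ q) h)%:E)%E.
Proof.
move=> t01 h0.
under eq_integral do rewrite hE.
rewrite ge0_integral_sum //.
- rewrite /Ex -sumEFin; apply: eq_bigr => E _.
  rewrite (@integralZl_indic _ _ _ _ _ _ (fun=> [set w | gph t w = E]) (h E)) //.
  + rewrite integral_indic //; last exact: measurable_fiber.
    by rewrite /= setIT prob_fiber // -EFinM mulrC.
  + by rewrite ltNge h0.
  + exact: measurable_fiber.
- by move=> E w _; rewrite lee_fin mulr_ge0 // indicE.
Qed.

(** Markov's inequality for a sum over several thresholds; by linearity the dependence between the
    threshold graphs is harmless. *)
Lemma markov_gph (I : Type) (s : seq I) (h : I -> {set edge n} -> R) (t : I -> R) (eps b : R) :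
  0 < eps -> (forall i, 0 <= t i <= 1) -> (forall i E, 0 <= h i E) ->
  \sum_(i <- s) Ex (t i `^ q) (h i) <= b ->
  (P [set w | eps <= \sum_(i <- s) h i (gph (t i) w)]%R <= (b / eps)%:E)%E.
Proof.
move=> eps0 t01 h0 Hb; set Y := fun w => \sum_(i <- s) h i (gph (t i) w).
have mY : measurable_fun setT Y by apply: measurable_sum => i; exact: measurable_gph.
have mA : measurable [set w | eps <= Y w].
  by rewrite -[X in measurable X]setTI; exact: measurable_fun_le.
have IY : (\int[P]_w (Y w)%:E = (\sum_(i <- s) Ex (t i `^ q) (h i))%:E)%E.
  rewrite -sumEFin; under eq_integral do rewrite /Y -sumEFin.
  rewrite ge0_integral_sum //.
  - by apply: eq_bigr => i _; rewrite integral_gph.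
  - by move=> i; apply/measurable_EFinP; exact: measurable_gph.
  - by move=> i w _; rewrite lee_fin.
have H : (eps%:E * P [set w | eps <= Y w]%R <= \int[P]_w (Y w)%:E)%E.
  rewrite -(setIT [set w | eps <= Y w]) -integral_indic //.
  rewrite -(@integralZl_indic _ _ _ _ _ _ (fun=> [set w | eps <= Y w]) eps) //; last first.
    by rewrite ltNge (ltW eps0).
  apply: ge0_le_integral => //.
  - by move=> w _; rewrite lee_fin mulr_ge0 ?(ltW eps0) // indicE.
  - apply/measurable_EFinP; apply: measurable_funM => //; exact: measurable_indic.
  - exact/measurable_EFinP.
  - move=> w _; rewrite lee_fin indicE; case: (boolP (w \in _)) => [|_].
      by rewrite inE mulr1.
    by rewrite mulr0; apply: sumr_ge0.
rewrite -(@lee_pmul2l _ eps%:E) // ?lte_fin //.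
apply: le_trans H _; rewrite IY -EFinM lee_fin mulrCA divff ?gt_eqF // mulr1 //.
Qed.

(** The law makes the weights nonnegative only almost surely, while [mst_weight_ge] asks for it at
    every edge; this null event is discarded in [mst_deviation]. *)
Lemma prob_negative : measurable [set w | exists e, X e w < 0] /\
  P [set w | exists e, X e w < 0] = 0%E.
Proof.
suff H (s : seq (edge n)) : measurable [set w | has (fun e => X e w < 0) s] /\
    P [set w | has (fun e => X e w < 0) s] = 0%E.
  have -> : [set w | exists e, X e w < 0] = [set w | has (fun e => X e w < 0) (index_enum (edge n))].
    apply/seteqP; split=> w /=; first by move=> [e Xe]; apply/hasP; exists e; rewrite ?mem_index_enum.
    by case/hasP => e _ Xe; exists e.
  exact: H.
elim: s => [|e s [IHm IH0]].
  have -> : [set w | has (fun e => X e w < 0) [::]] = set0 by apply/seteqP; split.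
  by rewrite measure0; split.
have me : measurable [set w | X e w < 0].
  have -> : [set w | X e w < 0] = X e @^-1` `]-oo, 0[%classic.
    by apply/seteqP; split=> w /=; rewrite in_itv.
  by apply: measurable_preim; exact: measurable_itv.
have -> : [set w | has (fun e => X e w < 0) (e :: s)] =
    [set w | X e w < 0] `|` [set w | has (fun e => X e w < 0) s].
  by apply/seteqP; split=> w /= /orP.
split; first exact: measurableU.
apply/eqP; rewrite eq_le measure_ge0 andbT.
have <- : (P [set w | X e w < 0]%R + P [set w | has (fun e => X e w < 0)%R s] = 0)%E.
  by rewrite (root_law_neg (lawX e)) IH0 adde0.
exact: measureU2.
Qed.

Lemma measurable_mst : (0 < n)%N ->
  measurable_fun setT (fun w => mst_weight (fun e => X e w)).
Proof.
move=> n0; pose F w (T : {set edge n}) := \sum_(e in T) X e w.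
have mF T : measurable_fun setT (fun w => F w T).
  by rewrite /F; under eq_fun do rewrite -big_enum; apply: measurable_sum.
pose s := [seq T <- index_enum {set edge n} | `[< spanning_tree T >]].
have [T0 hT0] : exists T : {set edge n}, spanning_tree T.
  by case: n n0 => // m _; exact: spanning_tree_exists.
(* The infimum is rewritten as a finite minimum; seeding it with a spanning tree [T0] leaves its
   value unchanged. *)
have mG : measurable_fun setT (fun w => \big[Order.min/F w T0]_(T <- s) F w T).
  elim: s => [|T s IH]; first by under eq_fun do rewrite big_nil; exact: mF.
  by under eq_fun do rewrite big_cons; exact: measurable_minr.
apply: eq_measurable_fun mG => w _.
have [[T hT ET] Hm] := mst_weight_min (fun e => X e w) n0.
have Ts : T \in s by rewrite mem_filter mem_index_enum andbT; apply/asboolP.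
apply/eqP; rewrite eq_le ET; apply/andP; split.
  elim: (s) Ts => // T' s' IH; rewrite inE big_cons ge_min => /orP[/eqP <-|/IH ->].
    by rewrite lexx.
  by rewrite orbT.
rewrite -ET; have : {in s, forall T', mst_weight (fun e => X e w) <= F w T'}.
  by move=> T'; rewrite mem_filter => /andP[/asboolP hT' _]; exact: Hm.
elim: {Ts} (s) => [|T' s' IH] Hs; first by rewrite big_nil; exact: Hm.
rewrite big_cons le_min Hs ?mem_head //=; apply: IH => T'' T''s.
by apply: Hs; rewrite inE T''s orbT.
Qed.

Lemma measurable_mst_deviation (a c r : R) : (0 < n)%N ->
  measurable [set w | r < `|a * mst_weight (fun e => X e w) - c|].
Proof.
move=> n0; set A := [set w | _].
have -> : A = ~` [set w | `|a * mst_weight (fun e => X e w) - c| <= r].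
  rewrite /A; apply/seteqP; split=> w /=; first by rewrite ltNge => /negP.
  by move/negP; rewrite -ltNge.
apply: measurableC; rewrite -[X in measurable X]setTI; apply: measurable_fun_le => //.
apply: measurableT_comp => //; apply: measurable_funB => //.
by apply: measurable_funM => //; exact: measurable_mst.
Qed.
End random_graph.

(** * Deviation bound for fixed n *)

Section triangle.
Variable R : realDomainType.
Implicit Types a g z : R.

Lemma dist2_up a g z : a <= `|a - g| + `|g - z| + z.
Proof. by have := ler_norm (a - g); have := ler_norm (g - z); lra. Qed.

Lemma dist2_lo a g z : z <= `|a - g| + `|g - z| + a.
Proof.
have := ler_norm (g - a); have := ler_norm (z - g).
by rewrite (distrC a) (distrC g z); lra.
Qed.

Lemma mulrDDr (h s1 s2 s3 : R) : h * (s1 + s2 + s3) = h * s1 + h * s2 + h * s3.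
Proof. by rewrite !mulrDr. Qed.

(** [F] is the rescaled tree weight, [S] the Kruskal sum, [s1] its random fluctuation, [s2] the bias
    and [s3] the upper Riemann sum. In [combine_lo], [r] is the cost of the [-1] in [kappa - 1]. *)
Lemma combine_up (F S Y b h c lo s1 s2 s3 tau : R) :
  F <= S -> S <= s1 + s2 + s3 -> s1 <= Y -> s2 <= 2 * b -> s3 <= lo + h ->
  lo <= c -> 0 <= b -> 0 <= tau -> F - c <= Y + 3 * b + h + tau.
Proof. lra. Qed.

Lemma combine_lo (F S Y b h c lo r s1 s2 tau : R) :
  S - r <= F -> lo <= s1 + s2 + S -> s1 <= Y -> s2 <= 2 * b -> r <= b ->
  c <= lo + h + tau -> - (Y + 3 * b + h + tau) <= F - c.
Proof. lra. Qed.
End triangle.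

Section finite_n.
Variables (R : realType) (q : R) (n i J : nat).
Hypotheses (q0 : 0 < q) (n0 : (0 < n)%N) (J0 : (0 < J)%N).
Hypothesis Jn : J%:R `^ q <= n%:R.

(** The grid in the scaling of the limit: at the threshold [tj j] the edge probability is
    [cj j / n], so the mean degree stays bounded as [n] grows with [j / 2^i] fixed. [b] is the
    common scale of bias and fluctuation, and [sc] normalises the tree weight. *)
Let N := (J * 2 ^ i)%N.
Let h : R := (2 ^+ i)^-1.
Let dl : R := n%:R `^ (- q^-1) * h.
Let tj (j : nat) : R := j%:R * dl.
Let cj (j : nat) : R := dyadic R i j `^ q.
Let b : R := J%:R * (1 + J%:R `^ q) / Num.sqrt n%:R.
Let sc : R := n%:R `^ (q^-1 - 1).

Let n0R : 0 < n%:R :> R. Proof. by rewrite ltr0n. Qed.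
Let J1R : 1 <= J%:R :> R. Proof. by rewrite ler1n. Qed.
Let s0 : 0 < Num.sqrt n%:R :> R. Proof. by rewrite sqrtr_gt0. Qed.
Let h0 : 0 < h. Proof. by rewrite invr_gt0 exprn_gt0. Qed.
Let h1 : h <= 1. Proof. by rewrite invf_le1 ?exprn_gt0 // exprn_ege1 // ler1n. Qed.
Let dl0 : 0 < dl. Proof. by rewrite mulr_gt0 ?powR_gt0. Qed.
Let Nh : N%:R * h = J%:R. Proof. exact: dyadic_nat. Qed.
Let Jq1 : 1 <= J%:R `^ q.
Proof. by rewrite -[X in X <= _](powRr0 J%:R) ler_powR // ltW. Qed.

Let scdl : sc * dl = h / n%:R.
Proof.
rewrite /sc /dl mulrA -powRD; last by rewrite (gt_eqF n0R) implybT.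
have -> : q^-1 - 1 + - q^-1 = - 1 by ring.
by rewrite powR_inv1 ?ltW // mulrC.
Qed.

Let cj_ge0 j : 0 <= cj j. Proof. exact: powR_ge0. Qed.

Let cj_le j : (j <= N)%N -> cj j <= J%:R `^ q.
Proof.
move=> jN; apply: ge0_ler_powR; rewrite ?nnegrE ?dyadic_ge0 ?(ltW q0) //.
by rewrite -Nh; apply: dyadic_le.
Qed.

Let tj_pow j : tj j `^ q = cj j / n%:R.
Proof.
have -> : tj j = dyadic R i j * n%:R `^ (- q^-1) by rewrite /tj /dl /dyadic /h; ring.
rewrite powRM ?dyadic_ge0 ?powR_ge0 // -powRrM mulNr mulVf ?gt_eqF //.
by rewrite powR_inv1 // ltW.
Qed.

Let tj01 j : (j <= N)%N -> 0 <= tj j <= 1.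
Proof.
move=> jN; have tj0 : 0 <= tj j by rewrite mulr_ge0 // ltW.
rewrite tj0 /= leNgt; apply/negP => tj1.
have : 1 < tj j `^ q.
  have := gt0_ltr_powR q0 _ _ tj1; rewrite powR1 /=; apply; rewrite nnegrE //.
rewrite tj_pow ltNge => /negP; apply; rewrite ler_pdivrMr // mul1r.
exact: le_trans (cj_le jN) Jn.
Qed.

Let mk j : mean_kappa n (cj j) = Ex (tj j `^ q) (fun E : {set edge n} => (kappa E)%:R) / n%:R.
Proof. by rewrite tj_pow. Qed.

Let bias j : (j <= N)%N -> `|mean_kappa n (cj j) - phi q (dyadic R i j)| <=
  2 * (1 + J%:R `^ q) / Num.sqrt n%:R.
Proof.
move=> jN; have H := cj_le jN.
apply: le_trans (mean_kappa_f n0 _) _; first by rewrite cj_ge0 (le_trans H).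
by rewrite ler_pM2r ?invr_gt0 // ler_pM2l // lerD2l.
Qed.

Let dev j (E : {set edge n}) : R := h * `|(kappa E)%:R / n%:R - mean_kappa n (cj j)|.

Let sum_h (m : nat) (F : nat -> R) (B : R) : (forall j, (j < m)%N -> F j <= B) ->
  h * (\sum_(0 <= j < m) F j) <= m%:R * h * B.
Proof.
move=> FB; rewrite [m%:R * h]mulrC -mulrA ler_pM2l //.
apply: (@le_trans _ _ (\sum_(0 <= j < m) B)); first by apply: ler_sum_nat => j /andP[_]; exact: FB.
by rewrite big_const_nat subn0 iter_addr_0 mulr_natl.
Qed.

Let bE : J%:R * (2 * (1 + J%:R `^ q) / Num.sqrt n%:R) = 2 * b.
Proof. by rewrite /b; ring. Qed.

(** The left side is what the [-1] of [kappa - 1] contributes over the whole grid. *)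
Let Jn_le : J%:R / n%:R <= b.
Proof.
have s1 : 1 <= Num.sqrt n%:R :> R by rewrite -[X in X <= _]sqrtr1 ler_wsqrtr // ler1n.
have sn : Num.sqrt n%:R * Num.sqrt n%:R = n%:R :> R by rewrite -expr2 sqr_sqrtr // ltW.
rewrite /b; have sle : Num.sqrt n%:R <= n%:R :> R by rewrite -[X in _ <= X]sn ler_pMr.
apply: (@le_trans _ _ (J%:R / Num.sqrt n%:R)).
  by rewrite ler_wpM2l // lef_pV2.
rewrite ler_pM2r ?invr_gt0 // ler_pMr; last by rewrite (lt_le_trans ltr01).
by rewrite lerDl (le_trans ler01).
Qed.

(** The deterministic part of the argument. The deviations are summed over [j <= N] because the
    upper bound uses the left endpoints and the lower bound the right ones. *)
Lemma grid_estimate (x : edge n -> R) (c tau : R) :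
  0 <= tau -> (forall e, 0 <= x e) -> (kappa (sublevel x (tj N)) <= 1)%N ->
  lower (phi q) i J <= c <= lower (phi q) i J + h + tau ->
  `|sc * mst_weight x - c| <=
    \sum_(0 <= j < N.+1) dev j (sublevel x (tj j)) + 3 * b + h + tau.
Proof.
move=> tau0 x0 k1 /andP[c1 c2].
have sc0 : 0 < sc by rewrite powR_gt0.
set Y := \sum_(0 <= j < N.+1) _.
pose K j : R := (kappa (sublevel x (tj j)))%:R / n%:R.
have Y1 : h * \sum_(0 <= j < N) `|K j - mean_kappa n (cj j)| <= Y.
  rewrite /Y big_nat_recr //= mulr_sumr lerDl mulr_ge0 ?(ltW h0) //.
have Y2 : h * \sum_(0 <= j < N) `|K j.+1 - mean_kappa n (cj j.+1)| <= Y.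
  rewrite /Y big_nat_recl //= mulr_sumr lerDr mulr_ge0 ?(ltW h0) //.
have B1 : h * \sum_(0 <= j < N) `|mean_kappa n (cj j) - phi q (dyadic R i j)| <= 2 * b.
  have := @sum_h N (fun j => `|mean_kappa n (cj j) - phi q (dyadic R i j)|) _
    (fun j jN => bias (ltnW jN)).
  by rewrite Nh bE.
have B2 : h * \sum_(0 <= j < N) `|mean_kappa n (cj j.+1) - phi q (dyadic R i j.+1)| <= 2 * b.
  have := @sum_h N (fun j => `|mean_kappa n (cj j.+1) - phi q (dyadic R i j.+1)|) _
    (fun j jN => bias jN).
  by rewrite Nh bE.
have U : sc * mst_weight x <= h * \sum_(0 <= j < N) K j.
  have H := mst_weight_le n0 (ltW dl0) k1.
  apply: le_trans (ler_wpM2l (ltW sc0) H) _.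
  rewrite mulr_sumr mulr_sumr; apply: ler_sum => j _.
  rewrite mulrA scdl -mulrA ler_pM2l // mulrC ler_wpM2r ?invr_ge0 // gerBl //.
have L : h * \sum_(0 <= j < N) K j.+1 - J%:R / n%:R <= sc * mst_weight x.
  have H := @mst_weight_ge R n x n0 dl N x0 (ltW dl0).
  apply: le_trans (ler_wpM2l (ltW sc0) H).
  rewrite [X in _ <= X]mulr_sumr.
  rewrite [X in _ <= X](eq_bigr (fun j => h * K j.+1 - h / n%:R)); last first.
    by move=> j _; rewrite [sc * (dl * _)]mulrA scdl /K; ring.
  rewrite sumrB -mulr_sumr big_const_nat subn0 iter_addr_0.
  by rewrite -[(h / n%:R) *+ N]mulr_natl mulrA Nh.
have U1 : \sum_(0 <= j < N) K j <= \sum_(0 <= j < N) `|K j - mean_kappa n (cj j)| +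
   \sum_(0 <= j < N) `|mean_kappa n (cj j) - phi q (dyadic R i j)| +
   \sum_(0 <= j < N) phi q (dyadic R i j).
  rewrite -!big_split /=; apply: ler_sum => j _.
  exact: dist2_up.
have L1 : \sum_(0 <= j < N) phi q (dyadic R i j.+1) <=
   \sum_(0 <= j < N) `|K j.+1 - mean_kappa n (cj j.+1)| +
   \sum_(0 <= j < N) `|mean_kappa n (cj j.+1) - phi q (dyadic R i j.+1)| +
   \sum_(0 <= j < N) K j.+1.
  rewrite -!big_split /=; apply: ler_sum => j _.
  exact: dist2_lo.
have up : h * \sum_(0 <= j < N) phi q (dyadic R i j) <= lower (phi q) i J + h.
  have := @upper_le_lower R (phi q) (@phi_ge0 R q) (@phi_le1 R q) i J.
  by rewrite /upper mul0n mulrC.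
have lo : lower (phi q) i J = h * \sum_(0 <= j < N) phi q (dyadic R i j.+1).
  by rewrite /lower mulrC.
have U2 := ler_wpM2l (ltW h0) U1; rewrite mulrDDr in U2.
have L2 := ler_wpM2l (ltW h0) L1; rewrite mulrDDr -lo in L2.
have b0 : 0 <= b by apply: le_trans Jn_le; rewrite divr_ge0.
rewrite ler_norml; apply/andP; split.
  exact: combine_lo L L2 Y2 B2 Jn_le c2.
exact: combine_up U U2 Y1 B1 up c1 b0 tau0.
Qed.

(** There are at most [n^2] edges, so the variance of [kappa] is at most [n * cj j], and
    [cj j <= J^q <= (J^q)^2]. Giving up a square root of [J^q] here costs nothing against the
    bias. *)
Let Ex_dev j : (j <= N)%N -> Ex (tj j `^ q) (dev j) <= h * (J%:R `^ q / Num.sqrt n%:R).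
Proof.
move=> jN; rewrite ExZ ler_pM2l //.
have p01 : 0 <= tj j `^ q <= 1.
  rewrite tj_pow divr_ge0 //= ler_pdivrMr // mul1r; exact: le_trans (cj_le jN) Jn.
rewrite (eq_Ex _ (g := fun E => n%:R^-1 * `|(kappa E)%:R - Ex (tj j `^ q) (fun E : {set edge n} => (kappa E)%:R)|)).
  rewrite ExZ mulrC ler_pdivrMr //.
  have -> : J%:R `^ q / Num.sqrt n%:R * n%:R = J%:R `^ q * Num.sqrt n%:R.
    by rewrite -{2}(sqr_sqrtr (ltW n0R)); field; rewrite gt_eqF.
  apply: (Ex_abs_dev p01 (@kappa_unit_decr R n)).
    by rewrite mulr_gt0 // (lt_le_trans ltr01).
  rewrite tj_pow exprMn sqr_sqrtr ?(ltW n0R) //.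
  rewrite mulrCA mulrC.
  have En : #|{: edge n}|%:R / n%:R <= n%:R :> R.
    rewrite ler_pdivrMr // -natrM ler_nat.
    have := @card_touch n [set: 'I_n]%SET; rewrite cardsT card_ord; apply: leq_trans.
    rewrite -cardsT; apply: subset_leq_card; apply/fintype.subsetP => e _.
    by apply: (fintype.subsetP (inside_touch _)); rewrite inE finset.subsetT.
  have cJ : cj j <= (J%:R `^ q) ^+ 2.
    by apply: le_trans (cj_le jN) _; rewrite expr2 ler_peMr // (le_trans ler01).
  by rewrite [X in _ <= X]mulrC; apply: ler_pM => //; rewrite divr_ge0.
move=> E; rewrite mk -[X in X * `|_|](ger0_norm (_ : 0 <= n%:R^-1)) ?invr_ge0 //.
by rewrite -normrM; congr (`|_|); ring.
Qed.

Variables (d : measure_display) (Omega : measurableType d).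
Variables (P : probability Omega R) (X : edge n -> {RV P >-> R}).
Hypotheses (indX : independent_RVs X) (lawX : forall e, uniform_root_law q (X e)).

(** Outside three events [grid_estimate] applies with deviations below [y]: a negative weight, a
    disconnected last graph, or a large total deviation. The probability bound is independent of the
    level [i]. *)
Lemma mst_deviation (c tau y r : R) : 0 < y -> 0 <= tau ->
  lower (phi q) i J <= c <= lower (phi q) i J + h + tau ->
  y + 3 * b + h + tau <= r ->
  (P [set w | (r < `|sc * mst_weight (fun e => X e w) - c|)%R] <=
   (2 * b / y + ((1 + expR (- (J%:R `^ q / 2))) ^+ n - 1))%:E)%E.
Proof.
move=> y0 tau0 Hc Hr; set A := [set w | _].
pose B1 := [set w | exists e, X e w < 0].
pose B2 := [set w | (1 < kappa (gph X (tj N) w))%N].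
(* [markov_gph] asks for thresholds in [[0, 1]] at every index, whence [minn j N]; it equals [j] on
   the range of the sum. *)
pose B3 := [set w | y <= \sum_(j <- index_iota 0 N.+1) dev (minn j N) (gph X (tj (minn j N)) w)].
have [mB1 PB1] := prob_negative lawX; rewrite -/B1 in mB1 PB1.
have t01 j : 0 <= tj (minn j N) <= 1 by apply: tj01; exact: geq_minr.
(* The event as a one-term sum of indicators, the shape that [markov_gph] takes. *)
have B2E : B2 = [set w | (1 : R) <= \sum_(j <- [:: tt]) (1 < kappa (gph X (tj N) w))%N%:R].
  by apply/seteqP; split=> w /=; rewrite big_seq1 ler1n lt0b.
have PB2 : (P B2 <= ((1 + expR (- (J%:R `^ q / 2))) ^+ n - 1)%:E)%E.
  rewrite B2E; apply: (le_trans (@markov_gph R q d Omega P n X q0 indX lawX unit [:: tt]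
    (fun _ E => (1 < kappa E)%N%:R) (fun=> tj N) 1 ((1 + expR (- (J%:R `^ q / 2))) ^+ n - 1) ltr01 _ _ _)).
  - by move=> _; exact: tj01.
  - by [].
  - rewrite big_seq1; have p1 := tj01 (leqnn N).
    have tN : tj N `^ q = J%:R `^ q / n%:R by rewrite tj_pow /cj dyadic_nat.
    have p01 : 0 <= tj N `^ q <= 1.
      by rewrite tN divr_ge0 ?powR_ge0 //= ler_pdivrMr // mul1r.
    apply: Ex_disconnected => // m nm.
    apply: le_trans (onem_le_exp m _) _; first by case/andP: p01.
    rewrite ler_expR lerN2 tN.
    have : n%:R / 2 <= m%:R :> R by rewrite ler_pdivrMr // -natrM ler_nat muln2.
    have -> : J%:R `^ q / 2 = n%:R / 2 * (J%:R `^ q / n%:R) by field; rewrite gt_eqF.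
    by move=> H; rewrite ler_wpM2r // divr_ge0 ?powR_ge0.
  - by rewrite divr1.
have PB3 : (P B3 <= (2 * b / y)%:E)%E.
  apply: (@markov_gph R q d Omega P n X q0 indX lawX nat (index_iota 0 N.+1)
    (fun j => dev (minn j N)) (fun j => tj (minn j N)) y (2 * b)) => //.
    by move=> j E; rewrite mulr_ge0 // ltW.
  apply: (@le_trans _ _ (\sum_(0 <= j < N.+1) h * (J%:R `^ q / Num.sqrt n%:R))).
    by apply: ler_sum => j _; apply: Ex_dev; exact: geq_minr.
  rewrite -mulr_sumr; apply: (le_trans (@sum_h N.+1 _ (J%:R `^ q / Num.sqrt n%:R) _)) => //.
  rewrite -natr1 mulrDl Nh mul1r.
  have -> : 2 * b = (2 * J%:R) * ((1 + J%:R `^ q) / Num.sqrt n%:R) by rewrite /b; ring.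
  apply: ler_pM.
  - by rewrite addr_ge0 // ltW.
  - by rewrite divr_ge0 ?powR_ge0.
  - by have := le_trans h1 J1R; lra.
  - by rewrite ler_pM2r ?invr_gt0 // lerDr.
have mB2 : measurable B2.
  rewrite B2E -[X in measurable X]setTI; apply: measurable_fun_le => //.
  by apply: measurable_sum => _; exact: (measurable_gph X (fun E => (1 < kappa E)%N%:R)).
have mB3 : measurable B3.
  rewrite -[X in measurable X]setTI; apply: measurable_fun_le => //.
  by apply: measurable_sum => j; exact: measurable_gph.
have AB : A `<=` B1 `|` (B2 `|` B3).
  move=> w Aw; apply: contrapT => /not_orP[nB1 /not_orP[nB2 nB3]].
  have x0 e : 0 <= X e w by rewrite leNgt; apply/negP => Xe; apply: nB1; exists e.
  have k1 : (kappa (sublevel (fun e => X e w) (tj N)) <= 1)%N.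
    by rewrite leqNgt; apply/negP.
  have := grid_estimate tau0 x0 k1 Hc.
  have /negP := nB3; rewrite -ltNge => Yy.
  have YE : \sum_(0 <= j < N.+1) dev j (sublevel (fun e => X e w) (tj j)) =
      \sum_(j <- index_iota 0 N.+1) dev (minn j N) (gph X (tj (minn j N)) w).
    by apply: eq_big_nat => j /andP[_]; rewrite ltnS => /minn_idPl ->.
  rewrite YE => H; move: Aw; rewrite /A /= ltNge => /negP; apply.
  by apply: (le_trans H); apply: le_trans Hr; rewrite !lerD2r; exact: ltW.
have mA : measurable A by exact: measurable_mst_deviation.
apply: (@le_trans _ _ (P (B1 `|` (B2 `|` B3)))).
  by apply: le_measure; rewrite ?inE //; do !apply: measurableU.
apply: (le_trans (measureU2 _ _ _)) => //; first exact: measurableU.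
rewrite [X in (X + _)%E]PB1 add0e.
apply: (le_trans (measureU2 _ _ _)) => //.
by rewrite EFinD addeC; apply: leeD.
Qed.
End finite_n.

(** * Choice of the truncation level *)

Section asymptotics.
Variables (R : realType) (q : R).
Hypothesis q0 : 0 < q.

Let al : R := q / (2 * (q + 1)).
Let eta : R := (2 * (q + 1) ^+ 2)^-1.

Let q1 : 0 < q + 1. Proof. by rewrite addr_gt0. Qed.
Let eta0 : 0 < eta. Proof. by rewrite invr_gt0 mulr_gt0 // exprn_gt0. Qed.
Let al0 : 0 < al. Proof. by rewrite divr_gt0 // mulr_gt0. Qed.
Let al1 : al <= 1.
Proof. by rewrite ler_pdivrMr ?mulr_gt0 // mul1r mulrDr mulr1; have := q0; lra. Qed.
Let etaq : 0 < 1 - eta * q.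
Proof.
rewrite subr_gt0 mulrC ltr_pdivrMr ?mulr_gt0 ?exprn_gt0 // mul1r sqrrD expr1n mulr1.
by have := exprn_gt0 2 q0; have := q0; lra.
Qed.
Let eta_al : eta * (1 + q) - 2^-1 = - al.
Proof. by rewrite /eta /al; field; rewrite !gt_eqF. Qed.

(** The successor makes the level positive and at least [n^eta]; since [n^eta >= 1] for positive
    [n], it is also at most [2 n^eta]. *)
Definition trunc_level (n : nat) : nat := (Num.trunc (n%:R `^ eta : R)).+1.

Lemma near_powRN (r eps : R) : 0 < r -> 0 < eps ->
  \forall n \near \oo, n%:R `^ (- r) <= eps.
Proof.
move=> r0 eps0; pose A := eps^-1 `^ r^-1.
have A0 : 0 < A by rewrite powR_gt0 // invr_gt0.
exists (Num.trunc A).+1 => // n /= An.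
have An' : A <= n%:R.
  by apply: ltW; apply: lt_le_trans (_ : (Num.trunc A).+1%:R <= _); rewrite ?ler_nat // -truncn_lt_nat // ltW.
have x0 : 0 < n%:R :> R := lt_le_trans A0 An'.
rewrite powRN invf_ple ?posrE ?powR_gt0 //.
have -> : eps^-1 = A `^ r by rewrite /A -powRrM mulVf ?gt_eqF // powRr1 // invr_ge0 ltW.
by apply: ge0_ler_powR; rewrite ?nnegrE ?(ltW r0) ?(ltW A0) ?ler0n.
Qed.

Section level.
Variable n : nat.
Hypothesis n0 : (0 < n)%N.
Let x : R := n%:R.
Let J := trunc_level n.
Let x1 : 1 <= x. Proof. by rewrite ler1n. Qed.
Let x0 : 0 < x. Proof. exact: lt_le_trans x1. Qed.
Let xe1 : 1 <= x `^ eta.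
Proof. by rewrite -[X in X <= _](powRr0 x) ler_powR // ltW. Qed.

Lemma level_ge : x `^ eta <= J%:R.
Proof. by rewrite ltW // -truncn_lt_nat // (le_trans ler01). Qed.

Lemma level_le : J%:R <= 2 * x `^ eta.
Proof.
have := truncn_itv (le_trans ler01 xe1) => /andP[H _].
by rewrite /J /trunc_level -natr1; have := xe1; move: H; rewrite -/x; lra.
Qed.

Let Jq_ge1 : 1 <= J%:R `^ q.
Proof. by rewrite -[X in X <= _](powRr0 J%:R) ler_powR ?ler1n // ltW. Qed.

Lemma level_pow_ge : x `^ (eta * q) <= J%:R `^ q.
Proof. by rewrite powRrM; apply: ge0_ler_powR; rewrite ?nnegrE ?powR_ge0 ?(ltW q0) ?level_ge. Qed.

Lemma level_pow_le r : 0 <= r -> J%:R `^ r <= 2 `^ r * x `^ (eta * r).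
Proof.
move=> r0; rewrite powRrM -powRM ?powR_ge0 //.
by apply: ge0_ler_powR; rewrite ?nnegrE ?mulr_ge0 ?powR_ge0 ?level_le.
Qed.

Lemma level_error : J%:R * (1 + J%:R `^ q) / Num.sqrt x <= 2 * 2 `^ (1 + q) * x `^ (- al).
Proof.
rewrite -powR12_sqrt ?(ltW x0) // -powRN.
have -> : x `^ (- al) = x `^ (eta * (1 + q)) * x `^ (- 2^-1).
  by rewrite -eta_al powRD // (gt_eqF x0) implybT.
rewrite mulrA ler_wpM2r ?powR_ge0 // -mulrA.
apply: (@le_trans _ _ (2 * J%:R `^ (1 + q))).
  rewrite powRD; last by rewrite pnatr_eq0 implybT.
  rewrite powRr1 // mulrCA ler_wpM2l //; have := Jq_ge1; lra.
by rewrite ler_wpM2l // level_pow_le // addr_ge0 // ltW.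
Qed.

(** The dyadic level is taken to be [n] itself, since the number of thresholds does not worsen the
    probability bound. *)
Lemma level_exp : (2 ^+ n)^-1 <= x `^ (- al).
Proof.
rewrite powRN lef_pV2 ?posrE ?exprn_gt0 ?powR_gt0 //.
apply: (@le_trans _ _ x).
  by rewrite -[X in _ <= X](powRr1 (ltW x0)) ler_powR.
by rewrite /x -natrX ler_nat ltnW // ltn_expl.
Qed.

Lemma level_tail (N : nat) : al / eta <= N%:R -> (J%:R ^+ N)^-1 <= x `^ (- al).
Proof.
move=> HN; have J0 : 0 < J%:R :> R by rewrite ltr0n.
rewrite powRN lef_pV2 ?posrE ?exprn_gt0 ?powR_gt0 //.
apply: (@le_trans _ _ ((x `^ eta) ^+ N)).
  rewrite -powR_mulrn ?powR_ge0 // -powRrM ler_powR //.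
  by rewrite mulrC -ler_pdivrMr.
by rewrite lerXn2r ?nnegrE ?powR_ge0 ?level_ge.
Qed.
End level.

Lemma near_level_le : \forall n \near \oo, (trunc_level n)%:R `^ q <= n%:R :> R.
Proof.
near=> n.
have n0 : (0 < n)%N by near: n; exists 1%N.
have x0 : 0 < n%:R :> R by rewrite ltr0n.
apply: (le_trans (level_pow_le n0 (ltW q0))).
have H : n%:R `^ (- (1 - eta * q)) <= (2 `^ q)^-1.
  by near: n; apply: near_powRN; rewrite // invr_gt0 powR_gt0.
rewrite powRN lef_pV2 ?posrE ?powR_gt0 // in H.
apply: le_trans (ler_wpM2r (powR_ge0 _ _) H) _.
rewrite -powRD; last by rewrite (gt_eqF x0) implybT.
by rewrite subrK powRr1 // ltW.
Unshelve. all: by end_near. Qed.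

Lemma near_connected (eps : R) : 0 < eps ->
  \forall n \near \oo, (1 + expR (- ((trunc_level n)%:R `^ q / 2))) ^+ n - 1 <= eps.
Proof.
move=> eps0.
(* Chosen so that the power [m + 1] of [J^q] is at least [n^2]; then [z] is of order [n^-2] and
   [n * z] tends to 0. *)
pose m := Num.trunc (2 / (eta * q)).
have eq0 : 0 < eta * q by rewrite mulr_gt0.
have mq : 2 <= eta * q * m.+1%:R.
  by rewrite mulrC -ler_pdivrMr // ltW // -truncn_lt_nat // divr_ge0 // ltW.
pose M : R := (2 * m.+1%:R) ^+ m.+1.
have M0 : 0 < M by rewrite exprn_gt0 // mulr_gt0.
(* The target is [n * z <= eps / (1 + eps)], because [e^(-u) >= 1 - u] then gives
   [e^(n z) <= 1 + eps]. *)
pose dd := eps / (1 + eps) / M.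
have e1 : 0 < 1 + eps by rewrite addr_gt0.
have dd0 : 0 < dd by rewrite !divr_gt0.
near=> n.
have n0 : (0 < n)%N by near: n; exists 1%N.
have x0 : 0 < n%:R :> R by rewrite ltr0n.
have x1 : 1 <= n%:R :> R by rewrite ler1n.
have Hd : n%:R `^ (- 1) <= dd by near: n; apply: near_powRN.
rewrite powR_inv1 ?(ltW x0) // in Hd.
set z := expR _.
have zM : z <= M / n%:R ^+ 2.
  rewrite /z expRN -[X in _ <= X]invrK lef_pV2 ?posrE ?expR_gt0 ?invr_gt0 ?divr_gt0 ?exprn_gt0 //.
  rewrite invf_div ler_pdivrMr //.
  have y0 : 0 <= (trunc_level n)%:R `^ q / 2 :> R by rewrite divr_ge0 // powR_ge0.
  have := expR_ge_pow m y0.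
  have -> : (trunc_level n)%:R `^ q / 2 / m.+1%:R = (trunc_level n)%:R `^ q / (2 * m.+1%:R) :> R.
    by rewrite invfM mulrA.
  rewrite expr_div_n -/M ler_pdivrMr // => H; apply: le_trans H.
  apply: (@le_trans _ _ ((n%:R `^ (eta * q)) ^+ m.+1)).
    by rewrite -!powR_mulrn ?powR_ge0 ?(ltW x0) // -powRrM ler_powR.
  by rewrite lerXn2r ?nnegrE ?powR_ge0 ?level_pow_ge.
have nz : n%:R * z <= eps / (1 + eps).
  apply: le_trans (ler_wpM2l (ltW x0) zM) _.
  have -> : n%:R * (M / n%:R ^+ 2) = M / n%:R by field; rewrite gt_eqF.
  have -> : eps / (1 + eps) = M * dd by rewrite /dd; field; rewrite !gt_eqF.
  by rewrite ler_pM2l.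
have H1 : (1 + z) ^+ n <= expR (n%:R * z).
  by rewrite expRM_natl lerXn2r ?nnegrE ?expR_ge0 ?addr_ge0 ?expR_ge0 ?expR_ge1Dx.
have H2 : expR (n%:R * z) <= 1 + eps.
  rewrite -[expR _]invrK -expRN -[X in _ <= X]invrK lef_pV2 ?posrE ?expR_gt0 ?invr_gt0 //.
  apply: le_trans (expR_ge1Dx _).
  have -> : (1 + eps)^-1 = 1 - eps / (1 + eps) by field; rewrite gt_eqF.
  by rewrite lerD2l lerN2.
by rewrite lerBlDl; apply: le_trans H1 H2.
Unshelve. all: by end_near. Qed.

Lemma relative_error (c m : R) (n : nat) : 0 < c -> (0 < n)%N ->
  `|m - c * n%:R `^ (1 - q^-1)| / (c * n%:R `^ (1 - q^-1)) =
  `|n%:R `^ (q^-1 - 1) * m - c| / c.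
Proof.
move=> c0 n0; have x0 : 0 < n%:R :> R by rewrite ltr0n.
have -> : n%:R `^ (1 - q^-1) = (n%:R `^ (q^-1 - 1))^-1 :> R by rewrite -powRN opprB.
set s := n%:R `^ _; have s0 : 0 < s by rewrite powR_gt0.
have -> : s * m - c = s * (m - c / s) by field; rewrite gt_eqF.
rewrite normrM (gtr0_norm s0); field; rewrite !gt_eqF //.
Qed.

(** The range of [n] is fixed before the probability space, so the bound can be used along a
    sequence of spaces that varies with [n]. *)
Lemma mst_concentration : exists2 c : R, 0 < c & forall eps : R, 0 < eps ->
  exists2 K : R, 0 < K & \forall n \near \oo,
  forall (d : measure_display) (Omega : measurableType d) (P : probability Omega R)
    (X : edge n -> {RV P >-> R}), independent_RVs X ->
    (forall e, uniform_root_law q (X e)) ->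
  (P [set w | (K * n%:R `^ (- al) <
     `|n%:R `^ (q^-1 - 1) * mst_weight (fun e => X e w) - c|)%R] <= eps%:E)%E.
Proof.
have [c c0 Hc] := constant_exists q0; exists c => // eps eps0.
pose N := (Num.trunc (al / eta)).+1.
have HN : al / eta <= N%:R by rewrite ltW // -truncn_lt_nat // divr_ge0 // ltW.
have [C C0 HC] := Hc N.
pose W : R := 2 * 2 `^ (1 + q).
have W0 : 0 < W by rewrite mulr_gt0 // powR_gt0.
(* With [b <= W * D], taking [y = (4 W / eps) D] makes the Markov term [2 b / y] at most [eps / 2].
   The other summands pay for [3 b], the mesh and the tail of the integral. *)
exists (4 * W / eps + 3 * W + 1 + C).
  by rewrite ltr_wpDr // addr_gt0 // addr_gt0 // ?divr_gt0 ?mulr_gt0.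
have eps2 : 0 < eps / 2 by rewrite divr_gt0.
near=> n.
have n0 : (0 < n)%N by near: n; exists 1%N.
have x0 : 0 < n%:R :> R by rewrite ltr0n.
have Hconn : (1 + expR (- ((trunc_level n)%:R `^ q / 2))) ^+ n - 1 <= eps / 2.
  by near: n; exact: near_connected.
have HJ : (trunc_level n)%:R `^ q <= n%:R :> R by near: n; exact: near_level_le.
move=> d Omega P X indX lawX.
set D := n%:R `^ (- al); have D0 : 0 < D by rewrite powR_gt0.
have Hb := level_error n0; rewrite -/W -/D in Hb.
set b := _ / _ in Hb.
have b0 : 0 < b.
  rewrite divr_gt0 ?sqrtr_gt0 // mulr_gt0 ?ltr0n // ltr_wpDr // powR_ge0 //.
have He := level_exp n0; rewrite -/D in He.
have Ht := level_tail n0 HN; rewrite -/D in Ht.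
have y0 : 0 < 4 * W / eps * D by rewrite !mulr_gt0 // invr_gt0.
have tau0 : 0 <= C / (trunc_level n)%:R ^+ N by rewrite divr_ge0 // exprn_ge0.
have Hr : 4 * W / eps * D + 3 * b + (2 ^+ n)^-1 + C / (trunc_level n)%:R ^+ N <=
    (4 * W / eps + 3 * W + 1 + C) * D.
  have -> : (4 * W / eps + 3 * W + 1 + C) * D =
    4 * W / eps * D + 3 * (W * D) + D + C * D by ring.
  apply: lerD; last by rewrite ler_wpM2l.
  by apply: lerD => //; apply: lerD => //; rewrite ler_pM2l.
have := @mst_deviation R q n n (trunc_level n) q0 n0 isT HJ d Omega P X indX lawX
  c _ _ _ y0 tau0 (HC n (trunc_level n) isT) Hr.
move=> H; apply: (le_trans H).
rewrite lee_fin -/b.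
rewrite [X in _ <= X](splitr eps).
apply: lerD => //.
rewrite ler_pdivrMr //.
have -> : eps / 2 * (4 * W / eps * D) = 2 * (W * D) by field; rewrite gt_eqF.
by rewrite ler_pM2l.
Unshelve. all: by end_near. Qed.
End asymptotics.

(** * The relative error in probability *)

Theorem theorem2 (R : realType) (q : R) (q_gt0 : 0 < q) :
  exists2 c_q : R, 0 < c_q &
  forall (d : nat -> measure_display)
    (Omega : forall n : nat, measurableType (d n))
    (P : forall n : nat, probability (Omega n) R)
    (X : forall n : nat, edge n -> {RV (P n) >-> R}),
  (forall n : nat, independent_RVs (X n)) ->
  (forall (n : nat) (e : edge n), uniform_root_law q (X n e)) ->
  let L (n : nat) : R := c_q * n%:R `^ (1 - q^-1) in
  let M (n : nat) (w : Omega n) : R := mst_weight (fun e => X n e w) in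
  let err (n : nat) (w : Omega n) : R := `|M n w - L n| / L n in
  bigO_prob P err (fun n _ => n%:R `^ (- (q / (2 * (q + 1))))) /\
  littleo_prob P err (fun _ _ => 1).
Proof.
have [c c0 Hc] := mst_concentration q_gt0; exists c => //.
move=> d Omega P X indX lawX L M err.
pose al := q / (2 * (q + 1)).
have al0 : 0 < al by rewrite divr_gt0 // mulr_gt0 // addr_gt0.
have errE n w : (0 < n)%N -> err n w =
    `|n%:R `^ (q^-1 - 1) * mst_weight (fun e => X n e w) - c| / c.
  by move=> n0; rewrite /err /M /L relative_error.
split.
  move=> eps eps0; have [K K0 HK] := Hc _ eps0; exists (K / c); first by rewrite divr_gt0.
  near=> n.
  have n0 : (0 < n)%N by near: n; exists 1%N.
  have /(_ _ _ _ _ (indX n) (lawX n)) H : forall (d : measure_display)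
    (Omega : measurableType d) (P : probability Omega R)
    (X : edge n -> {RV P >-> R}), independent_RVs X ->
    (forall e, uniform_root_law q (X e)) ->
    (P [set w | (K * n%:R `^ (- al) <
       `|n%:R `^ (q^-1 - 1) * mst_weight (fun e => X e w) - c|)%R] <= eps%:E)%E.
    by near: n; exact: HK.
  set A := [set w | _] in H.
  have mA : measurable A by exact: measurable_mst_deviation.
  have -> : [set w | err n w <= K / c * n%:R `^ (- (q / (2 * (q + 1))))] = ~` A.
    have E w : (err n w <= K / c * n%:R `^ (- al)) = ~~ (K * n%:R `^ (- al) <
       `|n%:R `^ (q^-1 - 1) * mst_weight (fun e => X n e w) - c|).
      by rewrite errE // ler_pdivrMr // -leNgt mulrAC divfK ?gt_eqF.
    by rewrite /A; apply/seteqP; split=> w /=; rewrite E => /negP.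
  by rewrite probability_setC // EFinB leeB.
move=> eps eps0; apply/fine_cvgP.
have mS n : (0 < n)%N -> measurable [set w | eps < `|err n w / 1|].
  move=> n0; have -> : [set w | eps < `|err n w / 1|] =
    [set w | eps * c < `|n%:R `^ (q^-1 - 1) * mst_weight (fun e => X n e w) - c|].
    have E w : (eps < `|err n w / 1|) =
        (eps * c < `|n%:R `^ (q^-1 - 1) * mst_weight (fun e => X n e w) - c|).
      by rewrite divr1 errE // ger0_norm ?divr_ge0 ?(ltW c0) // ltr_pdivlMr.
    by apply/seteqP; split=> w /=; rewrite E.
  exact: measurable_mst_deviation.
split.
  near=> n; apply: fin_num_measure; apply: mS; near: n; by exists 1%N.
apply/cvgr0Pnorm_le => e e0.
have [K K0 HK] := Hc _ e0.
have Kc0 : 0 < eps * c / K by rewrite divr_gt0 // mulr_gt0.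
near=> n.
have n0 : (0 < n)%N by near: n; exists 1%N.
have /(_ _ _ _ _ (indX n) (lawX n)) H : forall (d : measure_display)
    (Omega : measurableType d) (P : probability Omega R)
    (X : edge n -> {RV P >-> R}), independent_RVs X ->
    (forall e, uniform_root_law q (X e)) ->
    (P [set w | (K * n%:R `^ (- al) <
       `|n%:R `^ (q^-1 - 1) * mst_weight (fun e => X e w) - c|)%R] <= e%:E)%E.
  by near: n; exact: HK.
(* Once [K n^(-al) <= eps * c], a relative error above [eps] lies in the event whose probability is
   bounded by [e]. *)
have Hd : n%:R `^ (- al) <= eps * c / K by near: n; exact: near_powRN.
rewrite /= ger0_norm ?fine_ge0 // -lee_fin fineK; last by apply: fin_num_measure; exact: mS.
apply: le_trans H; apply: le_measure; rewrite ?inE //.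
- exact: mS.
- exact: measurable_mst_deviation.
- move=> w /=; rewrite divr1 errE // ger0_norm ?divr_ge0 ?(ltW c0) // ltr_pdivlMr //.
  by apply: le_lt_trans; rewrite mulrC -ler_pdivlMr.
Unshelve. all: by end_near. Qed.
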